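(* Let $H$ be a bialgebra over a field $\Bbbk$. For a left $H$-module coalgebra $D$ define the functor $\Psi_D:\mathfrak{M}^D\to{}^H_H\mathfrak{M}^D$ by $\Psi_D(W)=H\otimes W$ (and $\Psi_D(f)=\mathrm{id}_H\otimes f$), with left $H$-coaction $\Delta_H\otimes\mathrm{id}_W$, right $D$-coaction $h\otimes w\mapsto h_{(1)}\otimes w_{(0)}\otimes h_{(2)}w_{(1)}$, and left $H$-action $h\cdot(h'\otimes w)=h_{(1)}h'\otimes h_{(2)}w$. Then the following are equivalent: (1) $H$ is a Hopf algebra; (2) $\Psi_D$ is an equivalence for all left $H$-module coalgebras $D$; (3) $\Psi_\Bbbk:\mathbf{Vec}\to{}^H_H\mathfrak{M}$ is an equivalence (where $\Bbbk$ is the trivial left $H$-module coalgebra, $h\lambda=\varepsilon(h)\lambda$); (4) $\Psi_H:\mathfrak{M}^H\to{}^H_H\mathfrak{M}^H$ is an equivalence (where $H$ is a left $H$-module coalgebra via multiplication). Moreover, if these conditions hold, then a quasi-inverse of $\Psi_D$ is given by $\Psi_D^{-1}(M)=\{m\in M\mid \rho^\ell_M(m)=1\otimes m\}$ for $M\in{}^H_H\mathfrak{M}^D$, regarded as a right $D$-subcomodule of $M$.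
   Context: A left $H$-module coalgebra is a coalgebra $D$ with left $H$-module structure such that $\Delta(hd)=h_{(1)}d_{(1)}\otimes h_{(2)}d_{(2)}$ and $\varepsilon(hd)=\varepsilon(h)\varepsilon(d)$. $\mathfrak{M}^D$ is the category of right $D$-comodules. $H$ is a left $H$-module coalgebra via left multiplication. For left $H$-module coalgebras $C,D$, ${}^C_H\mathfrak{M}^D$ is the category of $C$-$D$-bicomodules $M$ with a left $H$-action such that $\rho^\ell(hm)=h_{(1)}m_{(-1)}\otimes h_{(2)}m_{(0)}$ and $\rho^r(hm)=h_{(1)}m_{(0)}\otimes h_{(2)}m_{(1)}$, with $H$-linear bicolinear maps as morphisms; ${}^H_H\mathfrak{M}={}^H_H\mathfrak{M}^\Bbbk$ is the category of left Hopf modules.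
   Formalization: The left H-action on H⊗W is taken to be h·(h′⊗w)=hh′⊗w instead of h₍₁₎h′⊗h₍₂₎w, because W is only a right D-comodule and h₍₂₎w is undefined. *)

(* Defs.v *)
From HB Require Import structures.
From mathcomp Require Import all_boot all_order all_algebra.
From mathcomp Require Import boolp classical_sets functions.
Set Implicit Arguments. Unset Strict Implicit. Unset Printing Implicit Defensive.
Import GRing.Theory.
Local Open Scope ring_scope.

Section Tensor.
Variable F : fieldType.

Definition lin (U V : lmodType F) (f : U -> V) : Prop :=
  forall (a : F) (u v : U), f (a *: u + v) = a *: f u + f v.

Definition dual (V : lmodType F) := {f : V -> F^o | lin f}.

Lemma dualZ (V : lmodType F) (f : dual V) a v : sval f (a *: v) = a * sval f v.
Proof.
case: f => f lf /=.
have f0 : f 0 = 0.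
  have h := lf 1 0 0; rewrite !scale1r addr0 in h.
  by apply: (addrI (f 0)); rewrite addr0 -h.
by have := lf a v 0; rewrite addr0 f0 addr0.
Qed.

Variables V W : lmodType F.

Definition tfun := dual V -> dual W -> F^o.
HB.instance Definition _ := GRing.Lmodule.on tfun.

Definition tsum (s : seq (V * W)) : tfun :=
  fun f g => \sum_(p <- s) (sval f p.1 * sval g p.2).

Definition is_tensor : {pred tfun} :=
  fun phi => `[< exists s, phi = tsum s >].

Lemma is_tensor_closed : submod_closed is_tensor.
Proof.
split.
  apply/asboolP; exists [::]; apply/funext => f; apply/funext => g.
  by rewrite /tsum big_nil.
move=> a p q /asboolP [s ->] /asboolP [t ->]; apply/asboolP.
exists ([seq (a *: x.1, x.2) | x <- s] ++ t); apply/funext => f; apply/funext => g.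
rewrite /tsum big_cat big_map /=; congr (_ + _).
transitivity (a * \sum_(x <- s) sval f x.1 * sval g x.2); first by [].
rewrite mulr_sumr; apply: eq_bigr => x _.
by rewrite dualZ mulrA.
Qed.

HB.instance Definition _ := GRing.isSubmodClosed.Build F
  tfun is_tensor (GRing.submod_closed_semi is_tensor_closed).

Record tensor := Tensor { tval : tfun; _ : tval \in is_tensor }.
HB.instance Definition _ := [isSub for tval].
HB.instance Definition _ := [Choice of tensor by <:].
HB.instance Definition _ := [SubChoice_isSubLmodule of tensor by <:].

Definition tmk (v : V) (w : W) : tensor :=
  @Tensor (tsum [:: (v, w)]) (asboolT (ex_intro _ [:: (v, w)] erefl)).

Lemma tensor_rep (t : tensor) : exists s, tval t = tsum s.
Proof. case: t => phi H; exact: (asboolP _ H). Qed.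

Definition trep (t : tensor) : seq (V * W) := projT1 (cid (tensor_rep t)).

Definition tlift (U : lmodType F) (B : V -> W -> U) (t : tensor) : U :=
  \sum_(p <- trep t) B p.1 p.2.
End Tensor.

Arguments tmk {F V W}.
Arguments tlift {F V W U}.
Notation "u \ot v" := (tmk u v) (at level 40, left associativity).

Section TensorOps.
Variable F : fieldType.

Definition tmap (U V U' V' : lmodType F) (f : U -> U') (g : V -> V') :
    tensor U V -> tensor U' V' :=
  tlift (fun u v => f u \ot g v).

Definition tassoc (U V W : lmodType F) : tensor (tensor U V) W -> tensor U (tensor V W) :=
  tlift (fun x w => tlift (fun u v => u \ot (v \ot w)) x).

Definition tmul (A : algType F) (x y : tensor A A) : tensor A A :=
  tlift (fun x1 x2 => tlift (fun y1 y2 => (x1 * y1) \ot (x2 * y2)) y) x.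

Definition coalgebra (C : lmodType F) (D : C -> tensor C C) (e : C -> F^o)
    : Prop :=
  [/\ lin D, lin e,
      forall c, tassoc (tmap D id (D c)) = tmap id D (D c),
      forall c, tlift (fun x y => e x *: y) (D c) = c &
      forall c, tlift (fun x y => e y *: x) (D c) = c].

Definition bialgebra (H : algType F) (D : H -> tensor H H) (e : H -> F^o)
    : Prop :=
  [/\ coalgebra D e,
      D 1 = 1 \ot 1,
      forall x y, D (x * y) = tmul (D x) (D y),
      e 1 = 1 &
      forall x y, e (x * y) = e x * e y].

Definition hopf (H : algType F) (D : H -> tensor H H) (e : H -> F^o) : Prop :=
  exists S : H -> H, [/\ lin S,
    forall h, tlift (fun x y => S x * y) (D h) = e h *: 1 &
    forall h, tlift (fun x y => x * S y) (D h) = e h *: 1].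

Definition lmodule (H : algType F) (M : lmodType F) (act : H -> M -> M) : Prop :=
  [/\ forall h, lin (act h), forall m, lin (fun h => act h m),
      forall m, act 1 m = m &
      forall x y m, act (x * y) m = act x (act y m)].

Section ModCoalg.
Variable H : algType F.
Variable HD : H -> tensor H H.
Variable He : H -> F^o.

Record modcoalg := ModCoalg {
  mc_car : lmodType F;
  mc_D : mc_car -> tensor mc_car mc_car;
  mc_e : mc_car -> F^o;
  mc_act : H -> mc_car -> mc_car }.
Arguments mc_D : clear implicits.
Arguments mc_e : clear implicits.
Arguments mc_act : clear implicits.

Definition is_modcoalg (C : modcoalg) : Prop :=
  [/\ coalgebra (mc_D C) (mc_e C), lmodule (mc_act C),
      forall h c, mc_D C (mc_act C h c) =
        tlift (fun h1 h2 => tlift (fun c1 c2 =>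
           mc_act C h1 c1 \ot mc_act C h2 c2) (mc_D C c)) (HD h) &
      forall h c, mc_e C (mc_act C h c) = He h * mc_e C c].

Definition reg_mc : modcoalg := @ModCoalg H HD He (fun x y => x * y).

Definition triv_mc : modcoalg :=
  @ModCoalg F^o (fun a : F^o => (a : F) *: (1 \ot 1 : tensor F^o F^o)) (fun a => a) (fun h a => He h * a).

Record ccat := CCat {
  cob : Type;
  cvalid : cob -> Prop;
  ccar : cob -> Type;
  chom : forall X Y : cob, (ccar X -> ccar Y) -> Prop }.


Definition is_functor (C1 C2 : ccat) (Fo : cob C1 -> cob C2)
  (Fm : forall X Y : cob C1, (ccar X -> ccar Y) -> ccar (Fo X) -> ccar (Fo Y))
  : Prop :=
  [/\ forall X, cvalid X -> cvalid (Fo X),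
      forall X Y (f : ccar X -> ccar Y), cvalid X -> cvalid Y -> chom f ->
        chom (Fm X Y f),
      forall X, cvalid X -> forall x, Fm X X id x = x &
      forall X Y Z (f : ccar X -> ccar Y) (g : ccar Y -> ccar Z),
        cvalid X -> cvalid Y -> cvalid Z -> chom f -> chom g ->
        forall x, Fm X Z (g \o f) x = Fm Y Z g (Fm X Y f x)].

Definition ciso (C : ccat) (X Y : cob C) (f : ccar X -> ccar Y) : Prop :=
  chom f /\ exists g : ccar Y -> ccar X, [/\ chom g, cancel f g & cancel g f].

Definition quasi_inverse (C1 C2 : ccat) (Fo : cob C1 -> cob C2)
  (Fm : forall X Y : cob C1, (ccar X -> ccar Y) -> ccar (Fo X) -> ccar (Fo Y))
  (Go : cob C2 -> cob C1)
  (Gm : forall X Y : cob C2, (ccar X -> ccar Y) -> ccar (Go X) -> ccar (Go Y))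
  : Prop :=
  [/\ is_functor Fm, is_functor Gm,
      (exists eta : forall X : cob C1, ccar X -> ccar (Go (Fo X)),
        (forall X, cvalid X -> ciso (eta X)) /\
        (forall X Y (f : ccar X -> ccar Y), cvalid X -> cvalid Y -> chom f ->
           forall x, Gm _ _ (Fm X Y f) (eta X x) = eta Y (f x))) &
      (exists eps : forall Y : cob C2, ccar (Fo (Go Y)) -> ccar Y,
        (forall Y, cvalid Y -> ciso (eps Y)) /\
        (forall X Y (f : ccar X -> ccar Y), cvalid X -> cvalid Y -> chom f ->
           forall y, f (eps X y) = eps Y (Fm _ _ (Gm X Y f) y)))].

Definition equivalence (C1 C2 : ccat) (Fo : cob C1 -> cob C2)
  (Fm : forall X Y : cob C1, (ccar X -> ccar Y) -> ccar (Fo X) -> ccar (Fo Y))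
  : Prop :=
  exists Go Gm, @quasi_inverse C1 C2 Fo Fm Go Gm.

Record rcomod (C : modcoalg) := RComod {
  rc_car : lmodType F;
  rc_co : rc_car -> tensor rc_car (mc_car C) }.
Arguments rc_co : clear implicits.

Definition is_rcomod (C : modcoalg) (M : rcomod C) : Prop :=
  [/\ lin (rc_co C M),
      forall m, tassoc (tmap (rc_co C M) id (rc_co C M m))
                = tmap id (mc_D C) (rc_co C M m) &
      forall m, tlift (fun x d => (mc_e C d : F) *: x) (rc_co C M m) = m].

Definition rcomod_hom (C : modcoalg) (M N : rcomod C)
    (f : rc_car M -> rc_car N) : Prop :=
  lin f /\ forall m, rc_co C N (f m) = tmap f id (rc_co C M m).

Definition rcomod_cat (C : modcoalg) : ccat :=
  @CCat (rcomod C) (@is_rcomod C) (fun M => (rc_car M : Type)) (@rcomod_hom C).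

Record hmod (C D : modcoalg) := HMod {
  hm_car : lmodType F;
  hm_l : hm_car -> tensor (mc_car C) hm_car;
  hm_r : hm_car -> tensor hm_car (mc_car D);
  hm_act : H -> hm_car -> hm_car }.
Arguments hm_l : clear implicits.
Arguments hm_r : clear implicits.
Arguments hm_act : clear implicits.

Definition is_hmod (C D : modcoalg) (M : hmod C D) : Prop :=
  [/\ [/\ lin (hm_l C D M),
          forall m, tassoc (tmap (mc_D C) id (hm_l C D M m))
                    = tmap id (hm_l C D M) (hm_l C D M m) &
          forall m, tlift (fun c x => (mc_e C c : F) *: x) (hm_l C D M m) = m],
      is_rcomod (@RComod D (hm_car M) (hm_r C D M)),
      forall m, tassoc (tmap (hm_l C D M) id (hm_r C D M m))
                = tmap id (hm_r C D M) (hm_l C D M m),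
      lmodule (hm_act C D M) &
      (forall h m, hm_l C D M (hm_act C D M h m) =
        tlift (fun h1 h2 => tlift (fun c x =>
          mc_act C h1 c \ot hm_act C D M h2 x) (hm_l C D M m)) (HD h)) /\
      (forall h m, hm_r C D M (hm_act C D M h m) =
        tlift (fun h1 h2 => tlift (fun x d =>
          hm_act C D M h1 x \ot mc_act D h2 d) (hm_r C D M m)) (HD h))].

Definition hmod_hom (C D : modcoalg) (M N : hmod C D)
    (f : hm_car M -> hm_car N) : Prop :=
  [/\ lin f,
      forall m, hm_l C D N (f m) = tmap id f (hm_l C D M m),
      forall m, hm_r C D N (f m) = tmap f id (hm_r C D M m) &
      forall h m, f (hm_act C D M h m) = hm_act C D N h (f m)].

Definition hmod_cat (C D : modcoalg) : ccat :=
  @CCat (hmod C D) (@is_hmod C D) (fun M => (hm_car M : Type)) (@hmod_hom C D).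

Definition Psi_ob (D : modcoalg) (W : rcomod D) : hmod reg_mc D :=
  @HMod reg_mc D (tensor H (rc_car W))
    (fun t => tassoc (tmap HD id t))
    (tlift (fun h w => tlift (fun h1 h2 => tlift (fun w0 w1 =>
        (h1 \ot w0) \ot mc_act D h2 w1) (rc_co D W w)) (HD h)))
    (fun h => tmap (fun h' => h * h') id).

Definition Psi_mor (D : modcoalg) (W W' : rcomod D)
    (f : rc_car W -> rc_car W') : tensor H (rc_car W) -> tensor H (rc_car W') :=
  tmap id f.

Definition Psi_equiv (D : modcoalg) : Prop :=
  @equivalence (rcomod_cat D) (hmod_cat reg_mc D) (@Psi_ob D) (@Psi_mor D).

Definition coinv_quasi_inverse (D : modcoalg) : Prop :=
  exists (Go : hmod reg_mc D -> rcomod D)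
         (Gm : forall M N : hmod reg_mc D,
                 (hm_car M -> hm_car N) -> rc_car (Go M) -> rc_car (Go N)),
    @quasi_inverse (rcomod_cat D) (hmod_cat reg_mc D) (@Psi_ob D) (@Psi_mor D)
      Go Gm /\
    exists iota : forall M : hmod reg_mc D, rc_car (Go M) -> hm_car M,
      forall M : hmod reg_mc D, is_hmod M ->
      [/\ injective (iota M),
          lin (iota M),
          forall x, hm_r reg_mc D M (iota M x) = tmap (iota M) id (rc_co D (Go M) x),
          forall m, (exists x, m = iota M x) <-> hm_l reg_mc D M m = (1 : H) \ot m &
          forall (N : hmod reg_mc D) (f : hm_car M -> hm_car N),
            is_hmod N -> hmod_hom f ->
            forall x, iota N (Gm M N f x) = f (iota M x)].

End ModCoalg.
End TensorOps.

(* Main.v *)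
Require Import Defs.
From HB Require Import structures.
From mathcomp Require Import all_boot all_order all_algebra.
From mathcomp Require Import boolp classical_sets functions.
Local Open Scope ring_scope.
Set Implicit Arguments. Unset Strict Implicit. Unset Printing Implicit Defensive.
Import GRing.Theory.

(* For a Hopf algebra with antipode [S], the map [P m = S(m_(-1)) m_(0)] is a
   projection of a Hopf module [M] onto its coinvariants, and
   [h (x) m |-> h m] has inverse [m |-> m_(-1) (x) P(m_(0))].  That [P m] is
   coinvariant is obtained without the anticomultiplicativity of [S]: both
   [rho (P m)] and [1 (x) P m] are the unique [a m] with
   [m_(-1) a(m_(0)) = rho m], because [S] inverts that equation.

   Conversely, consider [H (x) H] with the diagonal action, left coaction
   [Delta (x) id] and either [id (x) Delta] or the trivial right coaction.  Its
   coinvariants are [1 (x) H], so if it is isomorphic to some [H (x) W], then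
   [can (h (x) y) = h_1 (x) h_2 y] is bijective, and
   [S h = (eps (x) id) (can^-1 (h (x) 1))] is an antipode. *)

(** * Linear maps out of the tensor product *)

Section Linear.
Variable F : fieldType.
Implicit Types U V W X : lmodType F.

Lemma lin0 U V (f : U -> V) : lin f -> f 0 = 0.
Proof.
move=> lf; have := lf 1 0 0; rewrite !scale1r addr0 => h.
by apply: (addrI (f 0)); rewrite addr0 -h.
Qed.

Lemma linD U V (f : U -> V) : lin f -> {morph f : x y / x + y}.
Proof. by move=> lf x y; have := lf 1 x y; rewrite !scale1r. Qed.

Lemma linZ U V (f : U -> V) : lin f -> forall a x, f (a *: x) = a *: f x.
Proof. by move=> lf a x; have := lf a x 0; rewrite (lin0 lf) !addr0. Qed.

Lemma lin_sum U V (f : U -> V) (I : Type) (r : seq I) (G : I -> U) :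
  lin f -> f (\sum_(i <- r) G i) = \sum_(i <- r) f (G i).
Proof. by move=> lf; apply: big_morph; [exact: linD | exact: lin0]. Qed.

Definition bilin U V W (B : U -> V -> W) : Prop :=
  (forall v, lin (fun u => B u v)) /\ (forall u, lin (B u)).

Definition trilin U V W X (T : U -> V -> W -> X) : Prop :=
  (forall u, bilin (T u)) /\ forall v w, lin (fun u => T u v w).

(** By Zorn, some subspace [A] containing [N] is maximal among those missing [u]. It is a complement
    of the line through [u], and [f] reads off the coefficient along that line. *)
Lemma separation V (N : V -> Prop) (u : V) :
    N 0 -> (forall a x y, N x -> N y -> N (a *: x + y)) -> ~ N u ->
  exists f : dual V, sval f u = 1 /\ forall x, N x -> sval f x = 0.
Proof.
move=> N0 NZD Nu.
(* [Zorn_bigcup] also asks [P] of the union of the empty chain, so the empty set has to satisfy [P].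
   It is not maximal, because [N] lies strictly above it. *)
pose P (A : set V) := [/\ forall a x y, A x -> A y -> A (a *: x + y), ~ A u
  & (forall x, ~ A x) \/ forall x, N x -> A x].
have [C CP Ctot|A [[AZD Au AN] Amax]] := @Zorn_bigcup V P.
  split.
  - move=> a x y [X CX Xx] [Y CY Yy].
    have [XY|YX] := Ctot _ _ CX CY.
      by exists Y => //; have [YZD _ _] := CP _ CY; apply: YZD => //; apply: XY.
    by exists X => //; have [XZD _ _] := CP _ CX; apply: XZD => //; apply: YX.
  - by case=> X CX; have [] := CP _ CX.
  - have [[X CX NX]|noX] := pselect (exists2 X, C X & forall x, N x -> X x).
      by right=> x Nx; exists X => //; apply: NX.
    left=> x [X CX Xx]; have [_ _ [X0|NX]] := CP _ CX; first exact: (X0 x).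
    by apply: noX; exists X.
have {}AN x : N x -> A x.
  move: x; case: AN => // A0.
  have PN : P N by split=> //; right.
  by case: (Amax N) => //; split=> [y /A0//|NA]; apply: (A0 0 (NA _ N0)).
have A0 : A 0 by apply: AN.
have AZ a x : A x -> A (a *: x) by move=> Ax; rewrite -[_ *: _]addr0; apply: AZD.
have AD x y : A x -> A y -> A (x + y).
  by move=> Ax Ay; rewrite -[x]scale1r; apply: AZD.
(* If [v] is outside [A], the larger subspace [B = A + F v] must contain [u], so some [u - d v] lies
   in [A]. Here [d] is nonzero since [u] is not in [A], and [c = d^-1] works. *)
have coefP v : exists c, A (v - c *: u).
  have [Av|Av] := pselect (A v); first by exists 0; rewrite scale0r subr0.
  pose B : set V := fun x => exists d, A (x - d *: v).
  have AB : (A `<` B)%classic.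
    split=> [x Ax|BA]; first by exists 0; rewrite scale0r subr0.
    by apply: Av; apply: BA; exists 1; rewrite scale1r subrr.
  have [d Ad] : B u.
    apply: contrapT => nBu; apply: (Amax _ AB); split=> //; last first.
      by right=> x /AN Ax; exists 0; rewrite scale0r subr0.
    move=> a x y [d Ad] [e Ae]; exists (a * d + e).
    rewrite (_ : _ - _ = a *: (x - d *: v) + (y - e *: v)); first exact: AZD.
    by rewrite scalerBr addrACA scalerDl scalerA opprD.
  have d0 : d != 0.
    by apply: contra_notN Au => /eqP d0; move: Ad; rewrite d0 scale0r subr0.
  exists d^-1; rewrite (_ : _ - _ = (- d^-1) *: (u - d *: v)); first exact: AZ.
  by rewrite scaleNr scalerBr scalerA mulVf // scale1r opprB.
pose f v := projT1 (cid (coefP v)).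
have fP v : A (v - f v *: u) by rewrite /f; case: cid.
have coef_uniq v c d : A (v - c *: u) -> A (v - d *: u) -> c = d.
  move=> Ac Ad; apply/eqP; rewrite -subr_eq0; apply: contra_notT Au => cd.
  rewrite -[u](scalerK cd); apply: AZ.
  rewrite (_ : _ *: _ = -1 *: (v - c *: u) + (v - d *: u)); first exact: AZD.
  by rewrite scaleN1r opprB addrA subrK scalerBl.
have lf : lin (f : V -> F^o).
  move=> a x y; apply: (coef_uniq (a *: x + y)); first exact: fP.
  rewrite (_ : _ - _ = a *: (x - f x *: u) + (y - f y *: u)); first exact: AZD.
  by rewrite scalerBr addrACA scalerDl scalerA opprD.
exists (exist _ (f : V -> F^o) lf); split=> [|x Nx] /=.
  by apply: (coef_uniq u); [exact: fP | rewrite scale1r subrr].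
by apply: (coef_uniq x); [exact: fP | rewrite scale0r subr0; exact: AN].
Qed.

Lemma dual_separates V (v : V) : (forall f : dual V, sval f v = 0) -> v = 0.
Proof.
move=> v0; apply: contrapT => nv.
have [||f [f1 _]] := separation (N := fun x => x = 0) _ _ nv => //.
  by move=> a x y -> ->; rewrite scaler0 addr0.
by move: f1; rewrite v0 => /eqP; rewrite eq_sym oner_eq0.
Qed.

(** The span of the first components, with one coefficient peeled off per entry so that inductions
    follow the list. *)
Fixpoint span_fst V W (s : seq (V * W)) (u : V) : Prop :=
  if s is p :: s' then exists c : F, span_fst s' (u - c *: p.1) else u = 0.

Lemma span_fstZD V W (s : seq (V * W)) a x y :
  span_fst s x -> span_fst s y -> span_fst s (a *: x + y).
Proof.
elim: s x y => [|p s IH] x y /= => [-> ->|[c xc] [d yd]].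
  by rewrite scaler0 addr0.
exists (a * c + d); have := IH _ _ xc yd.
by rewrite scalerBr addrACA scalerDl scalerA opprD.
Qed.

Lemma span_fst0 V W (s : seq (V * W)) : span_fst s 0.
Proof. by elim: s => //= p s IH; exists 0; rewrite scale0r subr0. Qed.

Lemma span_fst_mem V W (s : seq (V * W)) p : p \in s -> span_fst s p.1.
Proof.
elim: s => //= q s IH; rewrite in_cons => /orP[/eqP->|/IH ps].
  by exists 1; rewrite scale1r subrr; apply: span_fst0.
by exists 0; rewrite scale0r subr0.
Qed.

(* A first component dependent on the others is absorbed by changing the second ones. *)
Lemma span_fst_absorb V W (s : seq (V * W)) u w : span_fst s u ->
  exists s', size s' = size s /\
    forall X (B : V -> W -> X), bilin B ->
      \sum_(p <- s') B p.1 p.2 = B u w + \sum_(p <- s) B p.1 p.2.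
Proof.
elim: s u => [|p s IH] u /= => [->|[c /IH[s' [ss' Bs']]]].
  by exists [::]; split=> // X B [lB _]; rewrite !big_nil addr0 (lin0 (lB w)).
exists ((p.1, c *: w + p.2) :: s'); split=> [|X B bB]; first by rewrite /= ss'.
case: (bB) => lB rB.
rewrite !big_cons Bs' //= (rB p.1) (linD (lB w)).
rewrite -scaleN1r !(linZ (lB w)) scaleN1r.
by rewrite [c *: _ + _]addrC -!addrA [c *: _ + _]addrCA addNKr addrCA.
Qed.

(* The type [tensor V W] only records the pairing with [dual V] and [dual W], so
   this is what makes [tlift B] independent of the chosen representative. *)
Lemma tsum_eq0 V W (s : seq (V * W)) :
    (forall (f : dual V) (g : dual W), \sum_(p <- s) sval f p.1 * sval g p.2 = 0 :> F^o) ->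
  forall X (B : V -> W -> X), bilin B -> \sum_(p <- s) B p.1 p.2 = 0.
Proof.
(* Either way one entry disappears: a dependent [u] is absorbed into the others, and an independent
   one forces [w = 0]. *)
have [n] := ubnP (size s); elim: n s => // n IH [|[u w] s] /=.
  by move=> _ _ X B _; rewrite big_nil.
rewrite ltnS => sn s0 X B bB.
(* The pairing with two functionals is itself bilinear, so [span_fst_absorb] carries the hypothesis
   over to the shortened list. *)
have bm (f : dual V) (g : dual W) :
    bilin (fun x y => (sval f x * sval g y : F) : F^o).
  case: f g => f lf [g lg]; split=> [v|v] a x y /=.
    by rewrite lf mulrDl -scalerAl.
  by rewrite lg mulrDr -scalerAr.
have [us|us] := pselect (span_fst s u).
  have [s' [ss' Bs']] := span_fst_absorb w us.
  rewrite big_cons /= -Bs' //; apply: IH => //; first by rewrite ss'.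
  move=> f g.
  by have := s0 f g; rewrite big_cons /= -(Bs' _ _ (bm f g)).
(* With [f] equal to 1 at [u] and zero on the remaining first components, the hypothesis reduces to
   [g w = 0] for every [g]. *)
have [f [fu fs]] := separation (span_fst0 s) (@span_fstZD _ _ s) us.
have w0 : w = 0.
  apply: dual_separates => g; have := s0 f g.
  rewrite big_cons /= fu mul1r big_seq big1 ?addr0 // => p ps.
  by rewrite fs ?mul0r //; apply: span_fst_mem.
rewrite big_cons /= w0 (lin0 (bB.2 u)) add0r; apply: IH => // f' g'.
by have := s0 f' g'; rewrite big_cons /= w0 (lin0 (svalP g')) mulr0 add0r.
Qed.

(** The chosen representative and [s] have equal pairings, so their formal difference, written by
    negating first components, is killed by [tsum_eq0]. *)
Lemma tlift_tsum V W X (B : V -> W -> X) (t : tensor V W) s :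
  bilin B -> Defs.tval t = tsum s -> tlift B t = \sum_(p <- s) B p.1 p.2.
Proof.
move=> bB ts; rewrite /tlift /trep; case: cid => r /= tr.
apply/eqP; rewrite -subr_eq0; apply/eqP.
have := @tsum_eq0 V W (r ++ [seq (- p.1, p.2) | p <- s]) _ X B bB.
rewrite big_cat big_map /=.
under [X in _ + X]eq_bigr => p _.
  rewrite (_ : B _ _ = - B p.1 p.2); last first.
    by rewrite -scaleN1r (linZ (bB.1 _)) scaleN1r.
  over.
rewrite sumrN; apply=> f g; rewrite big_cat big_map /=.
have -> : \sum_(p <- r) sval f p.1 * sval g p.2 = tsum s f g by rewrite -ts tr.
rewrite /tsum -big_split /= big1 // => p _.
by rewrite -scaleN1r dualZ mulN1r mulNr subrr.
Qed.

End Linear.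

(** * Closure properties of linear maps *)

Section LinClosure.
Variable F : fieldType.
Implicit Types U V W X Y : lmodType F.

Lemma lin_id U : lin (fun x : U => x).
Proof. by []. Qed.

Lemma lin_comp U V W (g : V -> W) (f : U -> V) :
  lin g -> lin f -> lin (fun x => g (f x)).
Proof. by move=> lg lf a x y; rewrite lf lg. Qed.

Lemma lin_scalel U V (f : U -> F^o) (v : V) :
  lin f -> lin (fun x => (f x : F) *: v).
Proof. by move=> lf a x y; rewrite lf scalerDl scalerA. Qed.

Lemma lin_scaler U V (f : U -> V) (c : F) : lin f -> lin (fun x => c *: f x).
Proof. by move=> lf a x y; rewrite lf scalerDr !scalerA mulrC. Qed.

Lemma lin_mull U (A : algType F) (f : U -> A) (b : A) :
  lin f -> lin (fun x => f x * b).
Proof. by move=> lf a x y; rewrite lf mulrDl scalerAl. Qed.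

Lemma lin_mulr U (A : algType F) (f : U -> A) (b : A) :
  lin f -> lin (fun x => b * f x).
Proof. by move=> lf a x y; rewrite lf mulrDr scalerAr. Qed.

Lemma lin_tmkl U V W (f : U -> V) (w : W) : lin f -> lin (fun x => f x \ot w).
Proof.
move=> lf a x y; apply: val_inj; apply/funext => p; apply/funext => q /=.
rewrite lf /tsum big_seq1 /= (svalP p) mulrDl -mulrA.
by rewrite !fctE /tsum !big_seq1.
Qed.

Lemma lin_tmkr U V W (f : U -> W) (v : V) : lin f -> lin (fun x => v \ot f x).
Proof.
move=> lf a x y; apply: val_inj; apply/funext => p; apply/funext => q /=.
rewrite lf /tsum big_seq1 /= (svalP q) mulrDr mulrCA.
by rewrite !fctE /tsum !big_seq1.
Qed.

Lemma tlift_tmk V W X (B : V -> W -> X) u v : bilin B -> tlift B (u \ot v) = B u v.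
Proof. by move=> bB; rewrite (@tlift_tsum _ _ _ _ _ _ [:: (u, v)]) // big_seq1. Qed.

(** Scaling a representative of [x] and appending one of [y] represents the linear combination, and
    [tlift_tsum] permits computing with it. *)
Lemma lin_tlift_arg U V W X (B : V -> W -> X) (f : U -> tensor V W) :
  bilin B -> lin f -> lin (fun x => tlift B (f x)).
Proof.
move=> bB; apply: (@lin_comp _ _ _ (tlift B)) => a x y.
have [[s xs] [t yt]] := (tensor_rep x, tensor_rep y).
have axs : Defs.tval (a *: x + y) = tsum ([seq (a *: p.1, p.2) | p <- s] ++ t).
  apply/funext => f'; apply/funext => g'.
  rewrite [LHS]/(a *: Defs.tval x f' g' + Defs.tval y f' g') xs yt /tsum.
  rewrite big_cat big_map /= scaler_sumr; congr (_ + _).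
  by apply: eq_bigr => p _; rewrite dualZ -mulrA.
rewrite (tlift_tsum bB axs) (tlift_tsum bB xs) (tlift_tsum bB yt).
rewrite big_cat big_map /= scaler_sumr; congr (_ + _).
by apply: eq_bigr => p _; rewrite (linZ (bB.1 _)).
Qed.

(** As [t] is fixed, all the lifts run over the same representative and linearity holds term by
    term. *)
Lemma lin_tlift_fun U V W X (B : U -> V -> W -> X) (t : tensor V W) :
  (forall u v, lin (fun x => B x u v)) -> lin (fun x => tlift (B x) t).
Proof.
move=> lB a x y; rewrite /tlift scaler_sumr -big_split /=.
by apply: eq_bigr => p _; rewrite lB.
Qed.

Lemma lin_tmap_comp X U V U' V' (f : U -> U') (g : V -> V') (h : X -> tensor U V) :
  lin f -> lin g -> lin h -> lin (fun x => tmap f g (h x)).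
Proof.
move=> lf lg; apply: lin_tlift_arg; split=> z.
  exact: lin_tmkl.
exact: lin_tmkr.
Qed.

Lemma lin_tassoc_comp X U V W (h : X -> tensor (tensor U V) W) :
  lin h -> lin (fun x => tassoc (h x)).
Proof.
apply: lin_tlift_arg; split=> [w|t]; last first.
  by apply: lin_tlift_fun => u v; do 2!apply: lin_tmkr.
apply: (@lin_tlift_arg _ _ _ _ _ id) => //; split=> z; first exact: lin_tmkl.
by apply: lin_tmkr; apply: lin_tmkl.
Qed.

End LinClosure.

(** Proves (multi)linearity by descending through the term. Linearity of actions, coactions and
    abstract maps is taken from the context, which is why later proofs first introduce such facts by
    [have]. *)
Ltac lin_solve :=
  cbv beta;
  lazymatch goal with
  | |- trilin _ => split=> [?|? ?]; lin_solve
  | |- bilin _ => split=> ?; lin_solve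
  | |- forall _, _ => move=> ?; lin_solve
  | |- lin _ => first
     [ assumption
     | exact: lin_id
     | apply: lin_tmkl; lin_solve | apply: lin_tmkr; lin_solve
     | apply: lin_scalel; lin_solve | apply: lin_scaler; lin_solve
     | apply: lin_mull; lin_solve | apply: lin_mulr; lin_solve
     | apply: lin_tlift_arg; lin_solve
     | apply: lin_tlift_fun; lin_solve
     | apply: lin_tmap_comp; lin_solve | apply: lin_tassoc_comp; lin_solve
     | match goal with
       | H : lin _ |- _ => apply: (lin_comp H); lin_solve
       | H : bilin _ |- _ => first
           [ exact: H.1 | exact: H.2
           | apply: (lin_comp (H.1 _)); lin_solve
           | apply: (lin_comp (H.2 _)); lin_solve ]
       | H : trilin _ |- _ => first
           [ apply: (lin_comp (H.2 _ _)); lin_solve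
           | apply: (lin_comp ((H.1 _).1 _)); lin_solve
           | apply: (lin_comp ((H.1 _).2 _)); lin_solve ]
       | H : forall _, lin _ |- _ => first
           [ exact: H | apply: (lin_comp (H _)); lin_solve ]
       end ]
  end.

(** * Computation rules for maps out of tensor products *)

Section TensorCalculus.
Variable F : fieldType.
Implicit Types U V W X Y : lmodType F.

Lemma eq_tlift V W X (B B' : V -> W -> X) t :
  (forall u v, B u v = B' u v) -> tlift B t = tlift B' t.
Proof. by move=> BB'; apply: eq_bigr. Qed.

Lemma lin_tlift V W X Y (L : X -> Y) (B : V -> W -> X) (t : tensor V W) :
  lin L -> L (tlift B t) = tlift (fun u v => L (B u v)) t.
Proof. exact: lin_sum. Qed.

Lemma tlift_tlift U V W X Y (C : U -> V -> X) (B : W -> Y -> tensor U V) t : bilin C ->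
  tlift C (tlift B t) = tlift (fun w y => tlift C (B w y)) t.
Proof. by move=> bC; apply: lin_tlift; lin_solve. Qed.

Lemma tlift_exchange U V W Y X (B : U -> V -> W -> Y -> X)
    (s : tensor U V) (t : tensor W Y) :
  tlift (fun a b => tlift (B a b) t) s =
  tlift (fun c d => tlift (fun a b => B a b c d) s) t.
Proof. exact: exchange_big. Qed.

Lemma tlift_eta V W (t : tensor V W) : tlift (fun u v => u \ot v) t = t.
Proof.
rewrite /tlift /trep; case: cid => s /= ts; apply: val_inj => /=; rewrite ts.
apply/funext => f; apply/funext => g.
rewrite (@big_morph _ _ (fun z : tensor V W => Defs.tval z f g) 0 +%R) // /tsum.
by apply: eq_bigr => p _; rewrite /= /tsum big_seq1.
Qed.

(** By [tlift_eta] every tensor is a sum of pure ones. Most identities below are reduced to pure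
    tensors this way. *)
Lemma tensor_ext V W X (f g : tensor V W -> X) : lin f -> lin g ->
  (forall u v, f (u \ot v) = g (u \ot v)) -> f =1 g.
Proof.
move=> lf lg fg t; rewrite -(tlift_eta t) !lin_tlift //.
by apply: eq_tlift.
Qed.

Lemma tmap_tmk U V U' V' (f : U -> U') (g : V -> V') u v :
  lin f -> lin g -> tmap f g (u \ot v) = f u \ot g v.
Proof. by move=> lf lg; rewrite /tmap tlift_tmk //; lin_solve. Qed.

Lemma tlift_tmap U V U' V' X (f : U -> U') (g : V -> V') (B : U' -> V' -> X) t :
  bilin B -> tlift B (tmap f g t) = tlift (fun u v => B (f u) (g v)) t.
Proof.
move=> bB; rewrite /tmap tlift_tlift //.
by apply: eq_tlift => u v; rewrite tlift_tmk.
Qed.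

Lemma eq_tmap U V U' V' (f f' : U -> U') (g g' : V -> V') :
  f =1 f' -> g =1 g' -> tmap f g =1 tmap f' g'.
Proof. by move=> ff' gg' t; apply: eq_tlift => u v; rewrite ff' gg'. Qed.

Lemma tmap_comp U V U' V' U'' V'' (f : U -> U') (g : V -> V')
    (f' : U' -> U'') (g' : V' -> V'') t : lin f' -> lin g' ->
  tmap f' g' (tmap f g t) = tmap (f' \o f) (g' \o g) t.
Proof. by move=> lf lg; rewrite {1}/tmap tlift_tmap //; lin_solve. Qed.

Lemma tmap_id U V (t : tensor U V) : tmap id id t = t.
Proof. exact: tlift_eta. Qed.

Lemma tassoc_tmap U V W U' (f : U' -> tensor U V) (t : tensor U' W) :
  tassoc (tmap f id t) =
  tlift (fun m c => tlift (fun u v => u \ot (v \ot c)) (f m)) t.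
Proof. by rewrite /tassoc tlift_tmap //; lin_solve. Qed.

Lemma tmapr_eta U V W V' (g : V' -> tensor V W) (t : tensor U V') :
  tmap id g t = tlift (fun u x => tlift (fun v w => u \ot (v \ot w)) (g x)) t.
Proof.
apply: eq_tlift => u v; rewrite -[in LHS](tlift_eta (g v)).
by apply: (lin_tlift (L := fun z => u \ot z)); lin_solve.
Qed.

(** One statement for all coassociativity laws: [f] and [g] range over comultiplications and left or
    right coactions, and the law is read under the linear map induced by [T]. This lets it be used
    inside any Sweedler expression. *)
Lemma coassocE U V W U' V' X (f : U' -> tensor U V) (g : V' -> tensor V W)
    (s : tensor U' W) (t : tensor U V') (T : U -> V -> W -> X) : trilin T ->
  tassoc (tmap f id s) = tmap id g t ->
  tlift (fun m c => tlift (fun u v => T u v c) (f m)) s =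
  tlift (fun u x => tlift (T u) (g x)) t.
Proof.
move=> tT; rewrite tassoc_tmap tmapr_eta => /(congr1 (tlift (fun u => tlift (T u)))).
rewrite !tlift_tlift; [|lin_solve..] => E.
transitivity (tlift (fun w y => tlift (fun u => tlift (T u))
    (tlift (fun u v => u \ot (v \ot y)) (f w))) s).
  apply: eq_tlift => m c; rewrite tlift_tlift; last by lin_solve.
  by apply: eq_tlift => u v; rewrite !tlift_tmk //; lin_solve.
rewrite E; apply: eq_tlift => u x; rewrite tlift_tlift; last by lin_solve.
rewrite -[in RHS](tlift_eta (g x)) tlift_tlift; last by lin_solve.
by apply: eq_tlift => v w; rewrite !tlift_tmk //; lin_solve.
Qed.

End TensorCalculus.

(** * Sweedler calculus *)

(* Sweedler notation [B h_1 h_2] is encoded as [tlift B (HD h)].  On a goal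
   [t = ?x] this flattens [t] to nested [tlift]s over coactions of variables. *)
Ltac tnorm :=
  cbv beta;
  lazymatch goal with
  | |- tlift _ (tlift _ _) = _ =>
      etransitivity; [apply: tlift_tlift; lin_solve | tnorm]
  | |- tlift _ (_ \ot _) = _ =>
      etransitivity; [apply: tlift_tmk; lin_solve | tnorm]
  | |- tlift _ (tmap _ _ _) = _ =>
      etransitivity; [apply: tlift_tmap; lin_solve | tnorm]
  | |- tlift _ _ = _ => apply: eq_tlift => ? ?; tnorm
  | |- tmap ?f ?g ?t = ?r => change (tlift (fun u v => f u \ot g v) t = r); tnorm
  | |- _ = _ => reflexivity
  end.

Ltac tnl := etransitivity; [tnorm | cbv beta].
Ltac tnr := symmetry; tnl; symmetry.

(** * Bialgebra identities, free left comodules and diagonal actions *)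

Section Bialgebra.
Variables (F : fieldType) (H : algType F).
Variables (HD : H -> tensor H H) (He : H -> F^o).
Hypothesis bH : bialgebra HD He.
Implicit Types U V W X : lmodType F.

Let HDlin : lin HD. Proof. by case: bH => [[]]. Qed.
Let Helin : lin He. Proof. by case: bH => [[]]. Qed.

Lemma HD_coassoc X (T : H -> H -> H -> X) h : trilin T ->
  tlift (fun x y => tlift (fun a b => T a b y) (HD x)) (HD h) =
  tlift (fun x y => tlift (T x) (HD y)) (HD h).
Proof. by move=> tT; apply: coassocE => //; case: bH => [[]]. Qed.

Lemma HD_counitl X (f : H -> X) h : lin f ->
  tlift (fun x y => (He x : F) *: f y) (HD h) = f h.
Proof.
move=> lf; case: bH => [[_ _ _ cl _] _ _ _ _].
rewrite -[in RHS](cl h) (lin_tlift _ _ lf).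
by apply: eq_tlift => u v; rewrite (linZ lf).
Qed.

Lemma HD_counitr X (f : H -> X) h : lin f ->
  tlift (fun x y => (He y : F) *: f x) (HD h) = f h.
Proof.
move=> lf; case: bH => [[_ _ _ _ cr] _ _ _ _].
rewrite -[in RHS](cr h) (lin_tlift _ _ lf).
by apply: eq_tlift => u v; rewrite (linZ lf).
Qed.

Lemma HD_mul x y : HD (x * y) =
  tlift (fun x1 x2 => tlift (fun y1 y2 => (x1 * y1) \ot (x2 * y2)) (HD y)) (HD x).
Proof. by case: bH. Qed.

Lemma HD1 : HD 1 = 1 \ot 1. Proof. by case: bH. Qed.

Lemma He1 : He 1 = 1. Proof. by case: bH. Qed.

Lemma He_mul x y : He (x * y) = He x * He y. Proof. by case: bH. Qed.

(** The cofree left coaction [Delta (x) id] on [H (x) V], shared by [Psi_ob] and the test object of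
    the converse. *)
Definition lco V (t : tensor H V) : tensor H (tensor H V) := tassoc (tmap HD id t).

Lemma lcoE V h (v : V) : lco (h \ot v) = tlift (fun a b => a \ot (b \ot v)) (HD h).
Proof. by rewrite /lco tassoc_tmap tlift_tmk; [| lin_solve]. Qed.

Lemma lin_lco V : lin (@lco V).
Proof.
move=> a x y; rewrite /lco !tassoc_tmap; move: a x y.
by apply: lin_tlift_arg; lin_solve.
Qed.

(** The diagonal action on a tensor product. Compatibility of a coaction with an action says that
    the coaction is linear for it. *)
Definition dact U V (aU : H -> U -> U) (aV : H -> V -> V) h (t : tensor U V) :=
  tlift (fun h1 h2 => tlift (fun u v => aU h1 u \ot aV h2 v) t) (HD h).

Lemma dactE U V (aU : H -> U -> U) (aV : H -> V -> V) h u v :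
    lmodule aU -> lmodule aV ->
  dact aU aV h (u \ot v) = tlift (fun h1 h2 => aU h1 u \ot aV h2 v) (HD h).
Proof.
move=> [Ul Ur _ _] [Vl Vr _ _]; rewrite /dact.
by apply: eq_tlift => h1 h2; rewrite tlift_tmk //; lin_solve.
Qed.

Lemma dact_lmodule U V (aU : H -> U -> U) (aV : H -> V -> V) :
  lmodule aU -> lmodule aV -> lmodule (dact aU aV).
Proof.
move=> [Ul Ur U1 UM] [Vl Vr V1 VM].
have dl h : lin (dact aU aV h) by rewrite /dact; lin_solve.
split=> //.
- by move=> t; rewrite /dact; lin_solve.
- move=> t; rewrite /dact HD1 tlift_tmk; last by lin_solve.
  rewrite -[RHS]tlift_eta; apply: eq_tlift => u v.
  by rewrite U1 V1.
move=> x y; apply: tensor_ext => //; first exact: lin_comp.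
move=> u v; rewrite !dactE // HD_mul; tnl.
rewrite /dact; tnr; apply: eq_tlift => x1 x2; apply: eq_tlift => y1 y2.
by rewrite UM VM.
Qed.

Lemma mul_lmodule : lmodule (fun x y : H => x * y).
Proof.
split=> [h|m|m|x y m]; [by lin_solve|by lin_solve|exact: mul1r|].
by rewrite mulrA.
Qed.

Lemma lco_coassoc V (t : tensor H V) :
  tassoc (tmap HD id (lco t)) = tmap id (@lco V) (lco t).
Proof.
have ll := @lin_lco V; have ll' := @lin_lco (tensor H V).
move: t; apply: tensor_ext; [lin_solve..|] => h v.
rewrite tassoc_tmap tmapr_eta !lcoE; tnl; tnr.
transitivity (tlift (fun x y =>
  tlift (fun a b => x \ot (a \ot (b \ot v))) (HD y)) (HD h)).
  by rewrite -HD_coassoc //; lin_solve.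
apply: eq_tlift => x y; rewrite lcoE; tnr; reflexivity.
Qed.

Lemma lco_counit V (t : tensor H V) :
  tlift (fun c x => (He c : F) *: x) (lco t) = t.
Proof.
have ll := @lin_lco V; move: t; apply: tensor_ext => [||h v]; [lin_solve..|].
by rewrite lcoE; tnl; apply: (HD_counitl (f := fun y => y \ot v)); lin_solve.
Qed.

(** The counit applied to the middle leg: [h_1 (x) eps(h_2) w = h (x) w]. *)
Lemma lco_counit_mid V (t : tensor H V) :
  tlift (fun c x => c \ot tlift (fun h w => (He h : F) *: w) x) (lco t) = t.
Proof.
have ll := @lin_lco V.
move: t; apply: tensor_ext; [lin_solve..|] => h w.
rewrite lcoE; tnl.
rewrite -[RHS](HD_counitr (f := fun h => h \ot w)); last by lin_solve.
apply: eq_tlift => a b; rewrite tlift_tmk; last by lin_solve.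
by apply: (linZ (f := fun z => a \ot z)); lin_solve.
Qed.

(** The coinvariants of [H (x) V] are [1 (x) V]: substitute [1 (x) t] for the coaction in
    [lco_counit_mid]. *)
Lemma lco_coinv V (t : tensor H V) :
  lco t = 1 \ot t -> t = 1 \ot tlift (fun h w => (He h : F) *: w) t.
Proof. by move=> lt; rewrite -[LHS]lco_counit_mid lt tlift_tmk //; lin_solve. Qed.

Lemma lco_tmap V V' (f : V -> V') (t : tensor H V) : lin f ->
  lco (tmap id f t) = tmap id (tmap id f) (lco t).
Proof.
move=> lf; have ll := @lin_lco V; have ll' := @lin_lco V'.
move: t; apply: tensor_ext; [lin_solve..|] => h w.
rewrite tmap_tmk; [|lin_solve..].
rewrite !lcoE; tnr; apply: eq_tlift => a b.
by rewrite tmap_tmk //; lin_solve.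
Qed.

(** Multiplicativity and coassociativity of [Delta] bring both sides to
    [h_1 x_1 (x) h_2 x_2 (x) h_3 v]. *)
Lemma lco_dact V (aV : H -> V -> V) h t : lmodule aV ->
  lco (dact (fun x y : H => x * y) aV h t) =
  dact (fun x y : H => x * y) (dact (fun x y : H => x * y) aV) h (lco t).
Proof.
move=> mV; have mU := mul_lmodule; have mUV := dact_lmodule mU mV.
have mUUV := dact_lmodule mU mUV.
case: (mV) => Vl Vr V1 VM; case: (mUV) => ul ur u1 uM.
case: (mUUV) => uul _ _ _; have ll := @lin_lco V.
move: t; apply: tensor_ext => [||x v]; [lin_solve..|].
rewrite dactE // lcoE (lin_tlift _ _ ll) {1}/dact.
transitivity (tlift (fun h1 h2 => tlift (fun p q => tlift (fun x1 x2 =>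
   (p * x1) \ot ((q * x2) \ot aV h2 v)) (HD x)) (HD h1)) (HD h)).
  by apply: eq_tlift => h1 h2; rewrite lcoE HD_mul; tnl.
tnr; rewrite HD_coassoc; last by lin_solve.
apply: eq_tlift => h1 h2; rewrite tlift_exchange; apply: eq_tlift => x1 x2.
rewrite dactE // -(lin_tlift (L := fun z => (h1 * x1) \ot z)) //.
by lin_solve.
Qed.

End Bialgebra.

(** * The functor Psi *)

Section Comodules.
Variables (F : fieldType) (H : algType F).
Variables (HD : H -> tensor H H) (He : H -> F^o).
Hypothesis bH : bialgebra HD He.
Implicit Types U V W X : lmodType F.

Let HDlin : lin HD. Proof. by case: bH => [[]]. Qed.
Let Helin : lin He. Proof. by case: bH => [[]]. Qed.

Variable D : modcoalg H.
Hypothesis mD : is_modcoalg HD He D.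

Let DDlin : lin (@mc_D _ _ D). Proof. by case: mD => [[]]. Qed.
Let Delin : lin (@mc_e _ _ D). Proof. by case: mD => [[]]. Qed.
Let Dactl : forall h, lin (@mc_act _ _ D h). Proof. by case: mD => _ []. Qed.
Let Dactr : forall d, lin (fun h => @mc_act _ _ D h d).
Proof. by case: mD => _ []. Qed.

Lemma mc_D_act h d : @mc_D _ _ D (mc_act h d) =
  tlift (fun h1 h2 => tlift (fun c1 c2 =>
    mc_act h1 c1 \ot mc_act h2 c2) (mc_D d)) (HD h).
Proof. by case: mD. Qed.

Lemma rco_coassoc (W : rcomod D) X (T : rc_car W -> mc_car D -> mc_car D -> X) w :
  is_rcomod W -> trilin T ->
  tlift (fun x y => tlift (fun a b => T a b y) (rc_co x)) (rc_co w) =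
  tlift (fun x y => tlift (T x) (mc_D y)) (rc_co w).
Proof. by move=> [lr ca _] tT; apply: coassocE. Qed.

Lemma rco_counit (W : rcomod D) X (f : rc_car W -> X) w : is_rcomod W -> lin f ->
  tlift (fun x y => (mc_e y : F) *: f x) (rc_co w) = f w.
Proof.
move=> [_ _ cu] lf; rewrite -[in RHS](cu w) (lin_tlift _ _ lf).
by apply: eq_tlift => u v; rewrite (linZ lf).
Qed.

Section PsiObject.
Variable W : rcomod D.
Hypothesis vW : is_rcomod W.

Let colin : lin (@rc_co _ _ _ W). Proof. by case: vW. Qed.

Let psi_r := @hm_r _ _ _ _ (Psi_ob HD He W).

Lemma Psi_rE h w : psi_r (h \ot w) =
  tlift (fun h1 h2 => tlift (fun w0 w1 =>
    (h1 \ot w0) \ot mc_act h2 w1) (rc_co w)) (HD h).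
Proof. by rewrite [LHS]tlift_tmk //; lin_solve. Qed.

Lemma lin_Psi_r : lin psi_r.
Proof. by rewrite /psi_r /=; lin_solve. Qed.

Let psilin := lin_Psi_r.

(** Both sides equal [h_1 (x) w_0 (x) h_2 w_1 (x) h_3 w_2], by coassociativity of [H] and of [W] and
    the compatibility [mc_D_act]. *)
Lemma Psi_r_coassoc t :
  tassoc (tmap psi_r id (psi_r t)) = tmap id (@mc_D _ _ D) (psi_r t).
Proof.
move: t; apply: tensor_ext; [lin_solve..|] => h w.
rewrite tassoc_tmap tmapr_eta Psi_rE; tnl; tnr.
transitivity (tlift (fun h1 h2 => tlift (fun a b => tlift (fun w0 w1 =>
  tlift (fun c d => (a \ot c) \ot (mc_act b d \ot mc_act h2 w1)) (rc_co w0))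
  (rc_co w)) (HD h1)) (HD h)).
  apply: eq_tlift => h1 h2; rewrite -tlift_exchange; apply: eq_tlift => w0 w1.
  by rewrite Psi_rE; tnl.
rewrite (HD_coassoc bH); last by lin_solve.
apply: eq_tlift => h1 h2.
transitivity (tlift (fun a b => tlift (fun w0 w1 => tlift (fun c d =>
  (h1 \ot w0) \ot (mc_act a c \ot mc_act b d)) (mc_D w1)) (rc_co w)) (HD h2)).
  apply: eq_tlift => a b.
  by apply: (rco_coassoc (T := fun x c d => (h1 \ot x) \ot (mc_act a c \ot mc_act b d)));
    [|lin_solve].
rewrite tlift_exchange; apply: eq_tlift => w0 w1.
by rewrite mc_D_act; tnr.
Qed.

Lemma Psi_r_counit t : tlift (fun x d => (mc_e d : F) *: x) (psi_r t) = t.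
Proof.
move: t; apply: tensor_ext; [lin_solve..|] => h w.
rewrite Psi_rE; tnl.
(* Since [eps(h_2 w_1) = eps(h_2) eps(w_1)], the counit law of [W] is used first and that of [H]
   afterwards. *)
transitivity (tlift (fun h1 h2 => (He h2 : F) *: (h1 \ot w)) (HD h)).
  apply: eq_tlift => h1 h2.
  rewrite -(rco_counit (f := fun w => (He h2 : F) *: (h1 \ot w))) //; last by lin_solve.
  apply: eq_tlift => w0 w1; case: mD => _ _ _ ->.
  by rewrite scalerA mulrC.
by apply: (HD_counitr bH (f := fun h => h \ot w)); lin_solve.
Qed.

(** Both composites give [h_1 (x) h_2 (x) w_0 (x) h_3 w_1]. *)
Lemma Psi_bicomodule t :
  tassoc (tmap (@lco _ _ HD _) id (psi_r t)) = tmap id psi_r (lco HD t).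
Proof.
have ll := lin_lco bH (V := rc_car W).
move: t; apply: tensor_ext; [lin_solve..|] => h w.
rewrite tassoc_tmap tmapr_eta Psi_rE (lcoE bH); tnl; tnr.
transitivity (tlift (fun h1 h2 => tlift (fun a b => tlift (fun w0 w1 =>
  a \ot ((b \ot w0) \ot mc_act h2 w1))
  (rc_co w)) (HD h1)) (HD h)).
  apply: eq_tlift => h1 h2; rewrite -tlift_exchange; apply: eq_tlift => w0 w1.
  by rewrite (lcoE bH); tnl.
rewrite (HD_coassoc bH); last by lin_solve.
by apply: eq_tlift => h1 h2; rewrite Psi_rE; tnr.
Qed.

Let actl h : lin (tmap (fun h' : H => h * h') (@id (rc_car W))).
Proof. by lin_solve. Qed.

Lemma Psi_lmodule :
  lmodule (fun h : H => tmap (fun h' : H => h * h') (@id (rc_car W))).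
Proof.
split=> //.
- by move=> m; rewrite /tmap; lin_solve.
- by move=> m; rewrite -[RHS]tmap_id; apply: eq_tmap => // x; rewrite /= mul1r.
move=> x y m; rewrite tmap_comp; [|lin_solve..].
by apply: eq_tmap => // z /=; rewrite mulrA.
Qed.

Lemma Psi_l_act h t : lco HD (tmap (fun h' : H => h * h') (@id (rc_car W)) t) =
  tlift (fun h1 h2 => tlift (fun c x => (h1 * c) \ot
    tmap (fun h' : H => h2 * h') (@id (rc_car W)) x) (lco HD t)) (HD h).
Proof.
have ll := lin_lco bH (V := rc_car W); have [_ actr _ _] := Psi_lmodule.
move: t; apply: tensor_ext; [lin_solve..|] => x w.
rewrite tmap_tmk; [|lin_solve..].
rewrite !(lcoE bH) (HD_mul bH); tnl; apply: eq_tlift => h1 h2; tnr.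
by apply: eq_tlift => x1 x2; rewrite tmap_tmk //; lin_solve.
Qed.

Lemma Psi_r_act h t : psi_r (tmap (fun h' : H => h * h') (@id (rc_car W)) t) =
  tlift (fun h1 h2 => tlift (fun x d => tmap (fun h' : H => h1 * h') (@id (rc_car W)) x
    \ot mc_act h2 d) (psi_r t)) (HD h).
Proof.
have [_ actr _ _] := Psi_lmodule.
move: t; apply: tensor_ext; [lin_solve..|] => x w.
rewrite tmap_tmk; [|lin_solve..].
rewrite !Psi_rE (HD_mul bH); tnl; apply: eq_tlift => h1 h2; tnr.
apply: eq_tlift => x1 x2; apply: eq_tlift => w0 w1.
rewrite tmap_tmk; [|lin_solve..].
by case: mD => _ [_ _ _ ->].
Qed.

Lemma Psi_valid : is_hmod HD (Psi_ob HD He W).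
Proof.
split; [split | split | | | split].
- exact: (lin_lco bH).
- exact: (lco_coassoc bH).
- exact: (lco_counit bH).
- exact: lin_Psi_r.
- exact: Psi_r_coassoc.
- exact: Psi_r_counit.
- exact: Psi_bicomodule.
- exact: Psi_lmodule.
- exact: Psi_l_act.
- exact: Psi_r_act.
Qed.

End PsiObject.

Lemma Psi_mor_hom (W W' : rcomod D) (f : rc_car W -> rc_car W') :
  is_rcomod W -> is_rcomod W' -> rcomod_hom f ->
  hmod_hom (M := Psi_ob HD He W) (N := Psi_ob HD He W') (tmap id f).
Proof.
move=> vW vW' [lf fco].
have [cl _ _] := vW; have [cl' _ _] := vW'.
have pl := lin_Psi_r vW; have pl' := lin_Psi_r vW'.
have ll := lin_lco bH (V := rc_car W); have ll' := lin_lco bH (V := rc_car W').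
have [al _ _ _] := Psi_lmodule W; have [al' _ _ _] := Psi_lmodule W'.
have mf : lin (tmap (@id H) f) by lin_solve.
split=> //.
- by move=> t; apply: (lco_tmap bH).
- apply: tensor_ext; [lin_solve..|] => h w.
  rewrite tmap_tmk; [|lin_solve..].
  rewrite !Psi_rE //; tnr; apply: eq_tlift => a b.
  rewrite fco; tnl; apply: eq_tlift => w0 w1.
  by rewrite tmap_tmk //; lin_solve.
- move=> h /= t; rewrite !tmap_comp //; lin_solve.
Qed.

Lemma Psi_functor :
  @is_functor (rcomod_cat D) (hmod_cat HD (reg_mc HD He) D)
    (@Psi_ob _ _ HD He D) (@Psi_mor _ _ D).
Proof.
split.
- by move=> W; apply: Psi_valid.
- by move=> W W' f vW vW' hf; apply: Psi_mor_hom.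
- by move=> W vW x; apply: tmap_id.
- move=> W1 W2 W3 f g _ _ _ [lf _] [lg _] x.
  by rewrite /Psi_mor tmap_comp //; lin_solve.
Qed.

End Comodules.

(** * Hopf modules over a Hopf algebra *)

Section HopfModules.
Variables (F : fieldType) (H : algType F).
Variables (HD : H -> tensor H H) (He : H -> F^o).
Hypothesis bH : bialgebra HD He.
Variable S : H -> H.
Hypothesis Slin : lin S.
Hypothesis S_mull : forall h, tlift (fun x y => S x * y) (HD h) = (He h : F) *: 1.
Hypothesis S_mulr : forall h, tlift (fun x y => x * S y) (HD h) = (He h : F) *: 1.
Implicit Types U V W X : lmodType F.

Let HDlin : lin HD. Proof. by case: bH => [[]]. Qed.
Let Helin : lin He. Proof. by case: bH => [[]]. Qed.

Lemma antipode1 : S 1 = 1.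
Proof.
have := S_mull 1; rewrite (HD1 bH) tlift_tmk; last by lin_solve.
by rewrite mulr1 (He1 bH) scale1r.
Qed.

(** * Convolution inverse of the identity acting on maps from a comodule to a module *)

Section LeftComodule.
Variables (M : lmodType F) (l : M -> tensor H M).
Hypothesis l_ca : forall m, tassoc (tmap HD id (l m)) = tmap id l (l m).
Hypothesis l_cu : forall m, tlift (fun c x => (He c : F) *: x) (l m) = m.

Lemma lcomod_coassoc X (T : H -> H -> M -> X) m : trilin T ->
  tlift (fun c x => tlift (fun a b => T a b x) (HD c)) (l m) =
  tlift (fun c x => tlift (T c) (l x)) (l m).
Proof. by move=> tT; apply: coassocE. Qed.

Lemma lcomod_counit X (f : M -> X) m : lin f ->
  tlift (fun c x => (He c : F) *: f x) (l m) = f m.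
Proof.
move=> lf; rewrite -[in RHS](l_cu m) (lin_tlift _ _ lf).
by apply: eq_tlift => u v; rewrite (linZ lf).
Qed.

Variables (N : lmodType F) (act : H -> N -> N).
Hypothesis mN : lmodule act.
Let actl : forall h, lin (act h). Proof. by case: mN. Qed.
Let actr : forall m, lin (fun h => act h m). Proof. by case: mN. Qed.

Lemma act_scale1 c n : act (c *: 1) n = c *: n.
Proof. by rewrite (linZ (actr n)); case: mN => _ _ ->. Qed.

Variables a b : M -> N.
Hypotheses (alin : lin a) (blin : lin b).

(** Linear maps [M -> N] form a module under convolution by endomorphisms of [H], and [S] is inverse
    to the identity: [a(m) = eps(m_(-1)) a(m_(0)) = S(m_(-2)) m_(-1) a(m_(0))]. *)
Lemma antipode_solve :
    (forall m, tlift (fun c x => act c (a x)) (l m) = b m) ->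
  forall m, a m = tlift (fun c x => act (S c) (b x)) (l m).
Proof.
move=> ab m.
transitivity (tlift (fun c x => tlift (fun d y => act (S c * d) (a y)) (l x)) (l m)).
  rewrite -(lcomod_coassoc (T := fun p q y => act (S p * q) (a y))); last by lin_solve.
  rewrite -(lcomod_counit m alin); apply: eq_tlift => c x.
  rewrite -act_scale1 -S_mull.
  by apply: (lin_tlift (L := fun h => act h (a x))).
apply: eq_tlift => c x; rewrite -ab (lin_tlift _ _ (actl _)).
by apply: eq_tlift => d y; case: mN.
Qed.

(** The converse direction, from the other antipode identity. *)
Lemma antipode_solved :
    (forall m, a m = tlift (fun c x => act (S c) (b x)) (l m)) ->
  forall m, tlift (fun c x => act c (a x)) (l m) = b m.
Proof.
move=> ab m.
transitivity (tlift (fun c x => tlift (fun d y => act (c * S d) (b y)) (l x)) (l m)).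
  apply: eq_tlift => c x; rewrite ab (lin_tlift _ _ (actl _)).
  by apply: eq_tlift => d y; case: mN.
rewrite -(lcomod_coassoc (T := fun p q y => act (p * S q) (b y))); last by lin_solve.
rewrite -(lcomod_counit m blin); apply: eq_tlift => c x.
rewrite -act_scale1 -S_mulr.
by symmetry; apply: (lin_tlift (L := fun h => act h (b x))).
Qed.

End LeftComodule.

(** * The projection of a Hopf module onto its coinvariants *)

Section CoinvariantProjection.
Variables (M : lmodType F) (l : M -> tensor H M) (act : H -> M -> M).
Hypothesis llin : lin l.
Hypothesis l_ca : forall m, tassoc (tmap HD id (l m)) = tmap id l (l m).
Hypothesis l_cu : forall m, tlift (fun c x => (He c : F) *: x) (l m) = m.
Hypothesis mM : lmodule act.
Hypothesis l_act : forall h m,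
  l (act h m) = dact HD (fun x y : H => x * y) act h (l m).

Let actl : forall h, lin (act h). Proof. by case: mM. Qed.
Let actr : forall m, lin (fun h => act h m). Proof. by case: mM. Qed.

Definition coproj m := tlift (fun c x => act (S c) x) (l m).

Lemma lin_coproj : lin coproj.
Proof. by rewrite /coproj; lin_solve. Qed.

Let Plin := lin_coproj.

Lemma coproj_act m : tlift (fun c x => act c (coproj x)) (l m) = m.
Proof. by move: m; apply: (antipode_solved l_ca l_cu mM (b := fun x => x)). Qed.

Lemma l_coproj m : l (coproj m) = 1 \ot coproj m.
Proof.
have mN := dact_lmodule bH (mul_lmodule H) mM; case: (mN) => nl nr _ _.
rewrite (antipode_solve l_ca l_cu mN (a := fun m => l (coproj m)) (b := l)).
- rewrite [RHS](antipode_solve l_ca l_cu mN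
    (a := fun m => 1 \ot coproj m) (b := l)) //; first by lin_solve.
  (* For [1 (x) P]: the diagonal action gives [m_(-2) (x) m_(-1) P(m_(0))], and [coproj_act]
     collapses the last two factors. *)
  move=> {}m; rewrite -[in RHS](tlift_eta (l m)).
  transitivity (tlift (fun c x => tlift (fun p q => p \ot act q (coproj x)) (HD c)) (l m)).
    apply: eq_tlift => c x; rewrite dactE //; last exact: mul_lmodule.
    by apply: eq_tlift => p q; rewrite mulr1.
  rewrite (lcomod_coassoc l_ca (T := fun p q y => p \ot act q (coproj y))); last by lin_solve.
  apply: eq_tlift => c x; rewrite -[in RHS](coproj_act x).
  by symmetry; apply: (lin_tlift (L := fun z => c \ot z)); lin_solve.
- by lin_solve.
(* For [l P]: apply [l] to [m = m_(-1) P(m_(0))] and use its compatibility with the action. *)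
- move=> {}m; rewrite -[in RHS](coproj_act m) (lin_tlift _ _ llin).
  by apply: eq_tlift => c x; rewrite l_act.
Qed.

Lemma coproj_id m : l m = 1 \ot m -> coproj m = m.
Proof.
move=> lm; rewrite /coproj lm tlift_tmk; last by lin_solve.
by rewrite antipode1; case: mM.
Qed.

Lemma l_act_coinv h m : l m = 1 \ot m ->
  l (act h m) = tlift (fun a b => a \ot act b m) (HD h).
Proof.
move=> lm; rewrite l_act lm dactE //; last exact: mul_lmodule.
by apply: eq_tlift => a b; rewrite mulr1.
Qed.

Lemma coproj_act_coinv h m : l m = 1 \ot m -> coproj (act h m) = (He h : F) *: m.
Proof.
move=> lm; rewrite /coproj l_act_coinv //; tnl.
rewrite -(act_scale1 mM) -S_mull (lin_tlift (L := fun h => act h m)) //.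
by apply: eq_tlift => a b; case: mM.
Qed.

(** The right coaction of a coinvariant has its left leg fixed by the projection: the bicomodule law
    moves [l] before [r], where it only contributes [S 1 = 1]. Hence the coinvariants form a
    subcomodule. *)
Lemma coproj_r V (r : M -> tensor M V) m : lin r ->
    tassoc (tmap l id (r m)) = tmap id r (l m) -> l m = 1 \ot m ->
  tmap coproj id (r m) = r m.
Proof.
move=> rlin lr lm.
transitivity (tlift (fun y d => tlift (fun c x => act (S c) x \ot d) (l y)) (r m)).
  apply: eq_tlift => y d.
  by apply: (lin_tlift (L := fun z => z \ot d)); lin_solve.
rewrite (coassocE (T := fun c x d => act (S c) x \ot d) _ lr); last by lin_solve.
rewrite lm tlift_tmk; last by lin_solve.
rewrite antipode1 -[RHS]tlift_eta; apply: eq_tlift => x d.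
by case: mM => _ _ ->.
Qed.

End CoinvariantProjection.

(** * The subspace of coinvariants *)

Section Coinvariants.
Variable D : modcoalg H.
Variable M : hmod (reg_mc HD He) D.

Let l : hm_car M -> tensor H (hm_car M) := @hm_l _ _ _ _ M.

(* Nothing is asked of invalid objects, whose coaction need not be linear, so
   that the coinvariants form a submodule for every [M]. *)
Definition is_coinv : {pred hm_car M} :=
  fun m => `[< is_hmod HD M -> l m = 1 \ot m >].

Lemma is_coinv_closed : submod_closed is_coinv.
Proof.
split.
  apply/asboolP => -[[llin _ _] _ _ _ _].
  by rewrite (lin0 (f := l)) // (lin0 (f := fun m => 1 \ot m)) //; lin_solve.
move=> a p q /asboolP lp /asboolP lq; apply/asboolP => vM.
case: (vM) => [[llin _ _] _ _ _ _].
have lin1 : lin (fun m : hm_car M => (1 : H) \ot m) by lin_solve.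
by rewrite (llin : lin l) lp // lq // (lin1 a p q).
Qed.

HB.instance Definition _ := GRing.isSubmodClosed.Build F
  (hm_car M) is_coinv (GRing.submod_closed_semi is_coinv_closed).

Record coinv := Coinv { cval : hm_car M; _ : cval \in is_coinv }.
HB.instance Definition _ := [isSub for cval].
HB.instance Definition _ := [Choice of coinv by <:].
HB.instance Definition _ := [SubChoice_isSubLmodule of coinv by <:].

(** Made total by the default value 0, which is never reached where [to_coinvK] applies. *)
Definition to_coinv (m : hm_car M) : coinv := insubd (0 : coinv) m.

Lemma lin_cval : lin cval.
Proof. by []. Qed.

Hypothesis vM : is_hmod HD M.

Lemma cvalP x : l (cval x) = 1 \ot cval x.
Proof. by case: x => m /= /asboolP; apply. Qed.

Lemma to_coinvK m : l m = 1 \ot m -> cval (to_coinv m) = m.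
Proof. by move=> lm; apply: insubdK; apply/asboolP. Qed.

Lemma cvalK x : to_coinv (cval x) = x.
Proof. by apply: val_inj; apply: to_coinvK; apply: cvalP. Qed.

End Coinvariants.

(** * The coinvariant functor as a quasi-inverse *)

Section CoinvariantFunctor.
Variable D : modcoalg H.
Hypothesis mD : is_modcoalg HD He D.

Let DDlin : lin (@mc_D _ _ D). Proof. by case: mD => [[]]. Qed.
Let Delin : lin (@mc_e _ _ D). Proof. by case: mD => [[]]. Qed.

Definition to_coinvariants (M : hmod (reg_mc HD He) D) (m : hm_car M) : coinv M :=
  to_coinv (coproj (@hm_l _ _ _ _ M) (@hm_act _ _ _ _ M) m).

(** The tensor product of [coinv M] with [D] is not literally a subset of that of [M] with [D], so
    the coaction is corestricted by projecting its left leg. [Coinv_co] shows that nothing is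
    lost. *)
Definition Coinv_ob (M : hmod (reg_mc HD He) D) : rcomod D :=
  @RComod _ _ D (coinv M)
    (fun x => tmap (@to_coinvariants M) id (@hm_r _ _ _ _ M (cval x))).

Definition Coinv_mor (M N : hmod (reg_mc HD He) D) (f : hm_car M -> hm_car N)
  (x : coinv M) : coinv N := to_coinv (f (cval x)).

Section Object.
Variable M : hmod (reg_mc HD He) D.
Hypothesis vM : is_hmod HD M.

Lemma cval_to_coinvariants m :
  cval (@to_coinvariants M m) = coproj (@hm_l _ _ _ _ M) (@hm_act _ _ _ _ M) m.
Proof.
apply: to_coinvK => //; case: vM => [[ll lca lcu] _ _ mM [lact _]].
exact: l_coproj.
Qed.

Lemma cval_inj : injective (@cval D M).
Proof. exact: val_inj. Qed.

Lemma lin_to_coinvariants : lin (@to_coinvariants M).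
Proof.
move=> a x y; apply: cval_inj; rewrite lin_cval !cval_to_coinvariants.
by apply: lin_coproj; case: vM => [[]].
Qed.

Lemma cval_to_coinvariantsK : cancel (@cval D M) (@to_coinvariants M).
Proof.
move=> x; apply: cval_inj; rewrite cval_to_coinvariants.
by apply: coproj_id; [case: vM | exact: cvalP].
Qed.

Lemma Coinv_co (x : coinv M) :
  @hm_r _ _ _ _ M (cval x) = tmap (@cval D M) id (@rc_co _ _ _ (Coinv_ob M) x).
Proof.
have cl := @lin_cval D M; have tl := lin_to_coinvariants.
rewrite /= tmap_comp //.
rewrite (eq_tmap (f' := coproj (@hm_l _ _ _ _ M) (@hm_act _ _ _ _ M)) (g' := id)) //.
  case: vM => [[ll lca lcu] [rl _ _] bi mM _].
  by rewrite coproj_r //; apply: cvalP.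
exact: cval_to_coinvariants.
Qed.

Lemma Coinv_valid : is_rcomod (Coinv_ob M).
Proof.
have tl := lin_to_coinvariants; have cl := @lin_cval D M.
case: (vM) => [_ [rl rca rcu] _ _ _].
have col : lin (@rc_co _ _ _ (Coinv_ob M)) by rewrite /=; lin_solve.
split=> // x.
  rewrite tassoc_tmap tmapr_eta.
  (* Everything is transported into [M], where coassociativity is known, with a projection only on
     the first leg. *)
  transitivity (tlift (fun y d => tlift (fun u v => to_coinvariants u \ot (v \ot d))
    (@hm_r _ _ _ _ M y)) (@hm_r _ _ _ _ M (cval x))).
    rewrite [in RHS]Coinv_co; tnr; apply: eq_tlift => m c.
    rewrite Coinv_co; tnr; apply: eq_tlift => u v.
    by rewrite cval_to_coinvariantsK.
  rewrite (rco_coassoc (W := RComod (@hm_r _ _ _ _ M))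
    (T := fun y u v => to_coinvariants y \ot (u \ot v))) //; last by lin_solve.
  by rewrite /=; tnr.
rewrite /=; tnl; rewrite -[RHS]cval_to_coinvariantsK.
exact: (rco_counit (W := RComod (@hm_r _ _ _ _ M))).
Qed.

Definition Coinv_counit (t : tensor H (coinv M)) : hm_car M :=
  tlift (fun h x => hm_act h (cval x)) t.

Definition Coinv_counit_inv (m : hm_car M) : tensor H (coinv M) :=
  tmap id (@to_coinvariants M) (@hm_l _ _ _ _ M m).

(** For coinvariant [x], [h x] goes to [h_1 (x) P(h_2 x) = h_1 (x) eps(h_2) x = h (x) x]. *)
Lemma Coinv_counitK : cancel Coinv_counit Coinv_counit_inv.
Proof.
have tl := lin_to_coinvariants; have cl := @lin_cval D M.
case: (vM) => [[ll lca lcu] _ _ mM [lact _]]; case: (mM) => al ar _ _.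
rewrite /Coinv_counit /Coinv_counit_inv => t; move: t.
apply: tensor_ext; [lin_solve..|] => h x.
rewrite tlift_tmk; last by lin_solve.
rewrite (l_act_coinv mM) //; last exact: cvalP; tnl.
rewrite -(HD_counitr bH (f := fun h => h \ot x)); last by lin_solve.
apply: eq_tlift => a b.
rewrite -(linZ (f := fun z => a \ot z)); last by lin_solve.
congr (_ \ot _); apply: cval_inj.
rewrite cval_to_coinvariants (linZ cl) coproj_act_coinv //; exact: cvalP.
Qed.

Lemma Coinv_counit_invK : cancel Coinv_counit_inv Coinv_counit.
Proof.
have tl := lin_to_coinvariants; have cl := @lin_cval D M.
case: (vM) => [[ll lca lcu] _ _ mM _]; case: (mM) => al ar _ _ m.
rewrite -[RHS](coproj_act lca lcu mM) /Coinv_counit /Coinv_counit_inv; tnl.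
by apply: eq_tlift => c x; rewrite cval_to_coinvariants.
Qed.

Lemma Coinv_counit_hom :
  hmod_hom (M := Psi_ob HD He (Coinv_ob M)) (N := M) Coinv_counit.
Proof.
have tl := lin_to_coinvariants; have cl := @lin_cval D M.
case: (vM) => [[ll lca lcu] [rl _ _] _ mM [lact ract]]; case: (mM) => al ar _ _.
have vP := Psi_valid bH mD Coinv_valid; case: (vP) => [[pll _ _] [prl _ _] _ pm _].
have [pal par _ _] := pm; have [_ [Dl Dr _ _] _ _] := mD.
have el : lin Coinv_counit by rewrite /Coinv_counit; lin_solve.
split=> //.
- apply: tensor_ext; [lin_solve..|] => h x.
  rewrite {1}/Coinv_counit tlift_tmk; last by lin_solve.
  rewrite (l_act_coinv mM) //; last exact: cvalP.
  transitivity (tmap id Coinv_counit (lco HD (h \ot x))); last by [].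
  rewrite (lcoE bH).
  tnr; apply: eq_tlift => a b; rewrite /Coinv_counit tlift_tmk //; lin_solve.
- apply: tensor_ext; [lin_solve..|] => h x.
  rewrite {1}/Coinv_counit tlift_tmk; last by lin_solve.
  rewrite ract Coinv_co Psi_rE //; last exact: Coinv_valid.
  tnl; tnr; apply: eq_tlift => a b; apply: eq_tlift => w0 w1.
  by rewrite /Coinv_counit tlift_tmk //; lin_solve.
- move=> h; apply: tensor_ext; [lin_solve..|] => h' x.
  rewrite [in LHS]/= tmap_tmk; [|lin_solve..].
  rewrite /Coinv_counit !tlift_tmk; [|lin_solve..].
  by case: mM.
Qed.

End Object.

Lemma Coinv_mor_val (M N : hmod (reg_mc HD He) D) (f : hm_car M -> hm_car N) x :
  is_hmod HD M -> is_hmod HD N -> hmod_hom f -> cval (Coinv_mor f x) = f (cval x).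
Proof.
move=> vM vN [lf fl _ _]; apply: to_coinvK => //.
by rewrite fl (cvalP vM) tmap_tmk.
Qed.

Lemma Coinv_mor_hom (M N : hmod (reg_mc HD He) D) (f : hm_car M -> hm_car N) :
  is_hmod HD M -> is_hmod HD N -> hmod_hom f ->
  rcomod_hom (M := Coinv_ob M) (N := Coinv_ob N) (Coinv_mor f).
Proof.
move=> vM vN hf; have vf := Coinv_mor_val _ vM vN hf; case: (hf) => lf fl fr fa.
have tl := lin_to_coinvariants vM; have tl' := lin_to_coinvariants vN.
have ml : lin (Coinv_mor f : coinv M -> coinv N).
  by move=> a x y; apply: cval_inj; rewrite lin_cval !vf lin_cval lf.
split=> // x; rewrite [LHS]/= vf fr (Coinv_co vM).
rewrite [LHS]tmap_comp // [LHS]tmap_comp //; last exact: lin_comp.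
apply: eq_tmap => // y /=.
by rewrite -(vf y) cval_to_coinvariantsK.
Qed.

Lemma Coinv_functor :
  @is_functor (hmod_cat HD (reg_mc HD He) D) (rcomod_cat D) Coinv_ob Coinv_mor.
Proof.
split.
- by move=> M; apply: Coinv_valid.
- by move=> M N f; apply: Coinv_mor_hom.
- by move=> M vM x; apply: cvalK.
- move=> M N P f g vM vN vP hf hg x; apply: cval_inj.
  rewrite (Coinv_mor_val _ vN vP hg) (Coinv_mor_val _ vM vN hf).
  apply: to_coinvK => //.
  rewrite /= -(Coinv_mor_val _ vM vN hf) -(Coinv_mor_val _ vN vP hg).
  exact: cvalP.
Qed.

(** A bijective morphism is an isomorphism, so [ciso] only requires a set-theoretic inverse;
    [hmod_hom_inv] serves the same purpose for Hopf modules. *)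
Lemma rcomod_hom_inv (W W' : rcomod D) (f : rc_car W -> rc_car W') g :
  rcomod_hom f -> cancel f g -> cancel g f -> rcomod_hom g.
Proof.
move=> [lf fco] fK gK.
have lg : lin g by move=> a x y; apply: (can_inj fK); rewrite lf !gK.
split=> // m; rewrite -[in RHS](gK m) fco tmap_comp //.
by rewrite -[LHS]tmap_id; apply: eq_tmap => // y /=; rewrite fK.
Qed.

Lemma hmod_hom_inv (M N : hmod (reg_mc HD He) D) (f : hm_car M -> hm_car N) g :
  hmod_hom f -> cancel f g -> cancel g f -> hmod_hom g.
Proof.
move=> [lf fl fr fa] fK gK.
have lg : lin g by move=> a x y; apply: (can_inj fK); rewrite lf !gK.
split=> // [m|m|h m].
- rewrite -[in RHS](gK m) fl tmap_comp //.
  by rewrite -[LHS]tmap_id; apply: eq_tmap => // y /=; rewrite fK.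
- rewrite -[in RHS](gK m) fr tmap_comp //.
  by rewrite -[LHS]tmap_id; apply: eq_tmap => // y /=; rewrite fK.
- by apply: (can_inj fK); rewrite fa !gK.
Qed.

Definition Coinv_unit (W : rcomod D) (w : rc_car W) : coinv (Psi_ob HD He W) :=
  to_coinv (1 \ot w : hm_car (Psi_ob HD He W)).

Lemma one_tmk_coinv (W : rcomod D) (w : rc_car W) :
  @hm_l _ _ _ _ (Psi_ob HD He W) (1 \ot w) = 1 \ot (1 \ot w).
Proof. by rewrite [LHS](lcoE bH) (HD1 bH) tlift_tmk //; lin_solve. Qed.

Lemma Coinv_unit_val (W : rcomod D) (w : rc_car W) :
  cval (Coinv_unit w) = 1 \ot w.
Proof. by apply: to_coinvK; apply: one_tmk_coinv. Qed.

Lemma Coinv_unit_iso (W : rcomod D) : is_rcomod W ->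
  @ciso (rcomod_cat D) W (Coinv_ob (Psi_ob HD He W)) (@Coinv_unit W).
Proof.
move=> vW; have vP := Psi_valid bH mD vW; have [cl _ _] := vW.
have tl := lin_to_coinvariants vP.
have uval (w : rc_car W) : cval (Coinv_unit w) = 1 \ot w := Coinv_unit_val w.
have hu : @rcomod_hom _ _ _ W (Coinv_ob (Psi_ob HD He W)) (@Coinv_unit W).
  have lu : lin (@Coinv_unit W : _ -> coinv (Psi_ob HD He W)).
    move=> a x y; apply: cval_inj; rewrite lin_cval !uval.
    exact: (lin_tmkr (1 : H) (@lin_id F (rc_car W))).
  split=> // w.
  transitivity (tmap (@to_coinvariants (Psi_ob HD He W)) id
    (@hm_r _ _ _ _ (Psi_ob HD He W) (cval (Coinv_unit w)))); first by [].
  rewrite uval Psi_rE // (HD1 bH).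
  have [_ [Dl Dr D1 _] _ _] := mD.
  tnl; tnr; apply: eq_tlift => w0 w1.
  by rewrite D1 -(uval w0) cval_to_coinvariantsK.
(* The inverse of [w |-> 1 (x) w] is [eps (x) id]; [lco_coinv] shows that it is also a right
   inverse. *)
pose g (x : coinv (Psi_ob HD He W)) : rc_car W :=
  tlift (fun h w => (He h : F) *: w) (cval x).
have uK : cancel (@Coinv_unit W) g.
  move=> w; rewrite /g uval tlift_tmk; last by lin_solve.
  by rewrite (He1 bH) scale1r.
have gK : cancel g (@Coinv_unit W).
  move=> x; apply: cval_inj; rewrite uval -(lco_coinv bH) //.
  exact: (cvalP vP).
split=> //; exists g; split=> //.
exact: (rcomod_hom_inv (W' := Coinv_ob (Psi_ob HD He W)) hu uK gK).
Qed.

Lemma Coinv_quasi_inverse :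
  @quasi_inverse (rcomod_cat D) (hmod_cat HD (reg_mc HD He) D)
    (@Psi_ob _ _ HD He D) (@Psi_mor _ _ D) Coinv_ob Coinv_mor.
Proof.
split; [exact: Psi_functor | exact: Coinv_functor | |].
- exists Coinv_unit; split; first exact: Coinv_unit_iso.
  move=> W W' f vW vW' hf w; apply: cval_inj.
  have vP := Psi_valid bH mD vW; have vP' := Psi_valid bH mD vW'.
  rewrite (Coinv_mor_val _ vP vP' (Psi_mor_hom bH mD vW vW' hf)).
  rewrite !Coinv_unit_val // /Psi_mor tmap_tmk //; first by case: hf.
- exists Coinv_counit; split=> [M vM|M N f vM vN hf].
    have hc := Coinv_counit_hom vM.
    split=> //; exists (@Coinv_counit_inv M).
    have cK := Coinv_counitK vM; have cK' := Coinv_counit_invK vM.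
    by split=> //; exact: (hmod_hom_inv (M := Psi_ob HD He (Coinv_ob M)) hc cK cK').
  have cl := @lin_cval D M; have cl' := @lin_cval D N.
  have [lf _ _ fa] := hf; have [lm _] := Coinv_mor_hom vM vN hf.
  have [_ _ _ [al ar _ _] _] := vM; have [_ _ _ [al' ar' _ _] _] := vN.
  apply: tensor_ext; rewrite /Coinv_counit; [lin_solve..|] => h x.
  rewrite /Psi_mor tmap_tmk //.
  rewrite !tlift_tmk; [|lin_solve..].
  by rewrite fa Coinv_mor_val.
Qed.

End CoinvariantFunctor.
End HopfModules.

(** The required embedding is [cval]: although [Coinv_ob] is built with [S], its coaction is the
    restriction of that of [M]. *)
Lemma hopf_coinv_quasi_inverse (F : fieldType) (H : algType F)
    (HD : H -> tensor H H) (He : H -> F^o) (D : modcoalg H) :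
  bialgebra HD He -> hopf HD He -> is_modcoalg HD He D ->
  coinv_quasi_inverse HD He D.
Proof.
move=> bH [S [Slin Sl Sr]] mD.
exists (@Coinv_ob _ _ HD He S D), (@Coinv_mor _ _ HD He D); split.
  exact: Coinv_quasi_inverse.
exists (@cval _ _ HD He D) => M vM; split.
- exact: cval_inj.
- exact: lin_cval.
- by move=> x; apply: Coinv_co.
- move=> m; split=> [[x ->]|lm]; first exact: cvalP.
  by exists (to_coinv m); rewrite to_coinvK.
- by move=> N f vN hf x; apply: Coinv_mor_val.
Qed.

(** * The antipode from an equivalence *)

Section ModuleCoalgebras.
Variables (F : fieldType) (H : algType F).
Variables (HD : H -> tensor H H) (He : H -> F^o).
Hypothesis bH : bialgebra HD He.
Implicit Types U V W X : lmodType F.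

Let HDlin : lin HD. Proof. by case: bH => [[]]. Qed.
Let Helin : lin He. Proof. by case: bH => [[]]. Qed.

(** * The regular and the trivial module coalgebra *)

Lemma reg_mc_valid : is_modcoalg HD He (reg_mc HD He).
Proof.
case: (bH) => cH _ _ _ eM; split=> //; first exact: mul_lmodule.
exact: HD_mul bH.
Qed.

Lemma regular_ext V (f g : F^o -> V) : lin f -> lin g -> f 1 = g 1 -> f =1 g.
Proof.
move=> lf lg fg a; have -> : a = (a : F) *: (1 : F^o) by rewrite -[RHS]/(a * 1) mulr1.
by rewrite (linZ lf) (linZ lg) fg.
Qed.

Lemma triv_mc_valid : is_modcoalg HD He (triv_mc He).
Proof.
pose d (a : F^o) : tensor F^o F^o := (a : F) *: (1 \ot 1).
have dlin : lin d by rewrite /d; lin_solve.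
have d1 : d 1 = 1 \ot 1 by rewrite /d scale1r.
have mull (a : F^o) : lin (fun x : F^o => a * x) by apply: (lin_mulr (A := F^o)).
have mulr (U : lmodType F) (f : U -> F^o) (a : F^o) : lin f -> lin (fun x => f x * a : F^o).
  exact: (lin_mull (A := F^o)).
have Hel (a : F^o) : lin (fun x => He x * a : F^o) by apply: mulr.
(* [F^o (x) F^o] is spanned by [1 (x) 1]; evaluate at 1 first in [b], then in [a]. *)
have d2 (a b : F^o) : a \ot b = (a : F) *: d b.
  rewrite /d; move: a b; have step (b : F^o) : (1 : F^o) \ot b = (b : F) *: (1 \ot 1).
    by move: b; apply: regular_ext; [lin_solve..|rewrite scale1r].
  move=> a b; move: a; apply: regular_ext; [lin_solve..|].
  by rewrite scale1r step.
change (is_modcoalg HD He (@ModCoalg _ _ F^o d (fun a => a) (fun h a => He h * a))).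
split=> /=.
- split=> //=.
  + apply: regular_ext; [lin_solve..|].
    by rewrite tassoc_tmap tmapr_eta !d1 !tlift_tmk ?d1 ?tlift_tmk //; lin_solve.
  + apply: regular_ext; [lin_solve..|].
    by rewrite d1 tlift_tmk ?scale1r //; lin_solve.
  + apply: regular_ext; [lin_solve..|].
    by rewrite d1 tlift_tmk ?scale1r //; lin_solve.
- split=> [h|m|m|x y m].
  + exact: mull.
  + exact: Hel.
  + by rewrite (He1 bH) mul1r.
  + by rewrite (He_mul bH) mulrA.
- move=> h; apply: regular_ext; [lin_solve..|].
  rewrite mulr1 d1 -(HD_counitl bH (f := fun x => d (He x))); last by lin_solve.
  by tnr; apply: eq_tlift => h1 h2; rewrite d2 !mulr1.
- by [].
Qed.

(** * The Hopf module [H (x) H] with diagonal action *)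

Section Galois.
Variable D : modcoalg H.
Hypothesis mD : is_modcoalg HD He D.
Variable rho : H -> tensor H (mc_car D).
Hypothesis vrho : is_rcomod (RComod rho).
Hypothesis rho_mul : forall h x, rho (h * x) =
  dact HD (fun x y : H => x * y) (@mc_act _ _ D) h (rho x).

Let DDlin : lin (@mc_D _ _ D). Proof. by case: mD => [[]]. Qed.
Let Delin : lin (@mc_e _ _ D). Proof. by case: mD => [[]]. Qed.
Let Dactl : forall h, lin (@mc_act _ _ D h). Proof. by case: mD => _ []. Qed.
Let Dactr : forall d, lin (fun h => @mc_act _ _ D h d).
Proof. by case: mD => _ []. Qed.
Let rholin : lin rho. Proof. by case: vrho. Qed.

Definition diag_r (t : tensor H H) : tensor (tensor H H) (mc_car D) :=
  tlift (fun x y => tlift (fun a d => (x \ot a) \ot d) (rho y)) t.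

(** An arbitrary [H]-linear coaction [rho] on [H] covers both converses: [rho] is [Delta] for the
    regular coalgebra and [h |-> h (x) 1] for the trivial one. *)
Definition diag_hmod : hmod (reg_mc HD He) D :=
  @HMod _ _ (reg_mc HD He) D (tensor H H) (@lco _ _ HD H) diag_r
    (dact HD (fun x y : H => x * y) (fun x y : H => x * y)).

Lemma diag_rE x y : diag_r (x \ot y) = tlift (fun a d => (x \ot a) \ot d) (rho y).
Proof. by rewrite /diag_r tlift_tmk //; lin_solve. Qed.

Lemma lin_diag_r : lin diag_r.
Proof. by rewrite /diag_r; lin_solve. Qed.

Lemma diag_valid : is_hmod HD diag_hmod.
Proof.
have ll := lin_lco bH (V := H); have rl := lin_diag_r.
have mH := mul_lmodule H; have mHH := dact_lmodule bH mH mH.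
have [al ar _ _] := mHH.
split; [split | split | | | split] => //=.
- exact: (lco_coassoc bH).
- exact: (lco_counit bH).
- apply: tensor_ext; [lin_solve..|] => x y.
  rewrite tassoc_tmap tmapr_eta diag_rE; tnl; tnr.
  rewrite -(rco_coassoc (W := RComod rho)
    (T := fun a d d' => (x \ot a) \ot (d \ot d'))) //; last by lin_solve.
  by apply: eq_tlift => a d; rewrite diag_rE; tnl.
- apply: tensor_ext; [lin_solve..|] => x y.
  rewrite diag_rE; tnl.
  apply: (rco_counit (W := RComod rho) (f := fun y => x \ot y)) => //; lin_solve.
- apply: tensor_ext; [lin_solve..|] => x y.
  rewrite tassoc_tmap tmapr_eta diag_rE (lcoE bH); tnl; tnr.
  transitivity (tlift (fun a d => tlift (fun p q => p \ot ((q \ot a) \ot d)) (HD x))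
    (rho y)).
    by apply: eq_tlift => a d; rewrite (lcoE bH); tnl.
  rewrite tlift_exchange; apply: eq_tlift => p q.
  by rewrite diag_rE; tnr.
- by move=> h m; apply: (lco_dact bH).
- move=> h; apply: tensor_ext; [lin_solve..|] => x y.
  rewrite dactE // (lin_tlift _ _ rl) diag_rE.
  (* Both sides are [h_1 x (x) h_2 y_0 (x) h_3 y_1]. *)
  transitivity (tlift (fun h1 h2 => tlift (fun p q => tlift (fun a d =>
     ((h1 * x) \ot (p * a)) \ot mc_act q d) (rho y)) (HD h2)) (HD h)).
    by apply: eq_tlift => h1 h2; rewrite diag_rE rho_mul /dact; tnl.
  rewrite -(HD_coassoc bH (T := fun h1 p q => tlift (fun a d =>
     ((h1 * x) \ot (p * a)) \ot mc_act q d) (rho y))); last by lin_solve.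
  apply: eq_tlift => h1 h2; tnr.
  rewrite tlift_exchange; apply: eq_tlift => a d.
  rewrite dactE //.
  by symmetry; apply: (lin_tlift (L := fun z => z \ot mc_act h2 d)); lin_solve.
Qed.

(** * The canonical map, its inverse and the antipode *)

Section Antipode.
Variables (W : lmodType F) (phi : tensor H W -> tensor H H) (psi : tensor H H -> tensor H W).
Hypotheses (phiK : cancel phi psi) (psiK : cancel psi phi).
Hypotheses (philin : lin phi) (psilin : lin psi).
Hypothesis phi_l : forall t, lco HD (phi t) = tmap id phi (lco HD t).
Hypothesis psi_l : forall t, lco HD (psi t) = tmap id psi (lco HD t).
Let dmul := dact HD (fun x y : H => x * y) (fun x y : H => x * y).
Hypothesis phi_act : forall h t, phi (tmap (fun x : H => h * x) id t) = dmul h (phi t).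

Let E V (t : tensor H V) : V := tlift (fun h w => (He h : F) *: w) t.
Let Elin V : lin (@E V). Proof. by rewrite /E; lin_solve. Qed.
(** [theta] identifies [W] with the coinvariants [1 (x) H]. Transporting [psi] along it gives
    [can'], the inverse of [can]. *)
Let theta w := E (phi (1 \ot w)).
Let can (t : tensor H H) := tlift (fun h y => tlift (fun a b => a \ot (b * y)) (HD h)) t.
Let can' t := tmap id theta (psi t).
Let S h := E (can' (h \ot 1)).

Let thetalin : lin theta. Proof. by rewrite /theta; lin_solve. Qed.
Let canlin : lin can. Proof. by rewrite /can; lin_solve. Qed.
Let canlin' : lin can'. Proof. by rewrite /can'; lin_solve. Qed.
Let Slin : lin S. Proof. by rewrite /S; lin_solve. Qed.

Lemma lco1 V (v : V) : lco HD (1 \ot v) = 1 \ot (1 \ot v).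
Proof. by rewrite (lcoE bH) (HD1 bH) tlift_tmk //; lin_solve. Qed.


Let theta_tmk w : 1 \ot theta w = phi (1 \ot w).
Proof. by symmetry; apply: (lco_coinv bH); rewrite phi_l lco1 tmap_tmk. Qed.

Let can_tmk h y : can (h \ot y) = dmul h (1 \ot y).
Proof.
rewrite /can tlift_tmk; last by lin_solve.
rewrite [RHS]dactE; [|exact: mul_lmodule..].
by apply: eq_tlift => a b; rewrite mulr1.
Qed.

(** Since [h (x) w = h (1 (x) w)] and [phi] is [H]-linear, [phi] sends it to [h (1 (x) theta w)],
    which is [can (h (x) theta w)]. *)
Let can_theta t : can (tmap id theta t) = phi t.
Proof.
move: t; apply: tensor_ext; [lin_solve..|] => h w.
by rewrite tmap_tmk // can_tmk theta_tmk -phi_act tmap_tmk ?mulr1 //; lin_solve.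
Qed.

Let canK' t : can (can' t) = t.
Proof. by rewrite /can' can_theta psiK. Qed.

Let E_can t : E (can t) = tlift (fun x y => x * y) t.
Proof.
move: t; apply: tensor_ext; [by lin_solve..|] => x y.
rewrite /can !tlift_tmk; [|lin_solve..]; rewrite /E; tnl.
by apply: (HD_counitl bH (f := fun b => b * y)); lin_solve.
Qed.

Let can'K t : can' (can t) = t.
Proof.
move: t; apply: tensor_ext; [by lin_solve..|] => h y.
(* By colinearity [psi] preserves coinvariants, so [y] has a preimage under [theta]. *)
have [w yw] : exists w, psi (1 \ot y) = 1 \ot w.
  exists (E (psi (1 \ot y))); apply: (lco_coinv bH).
  by rewrite psi_l lco1 tmap_tmk.
have wy : theta w = y.
  rewrite /theta -yw psiK /E tlift_tmk ?(He1 bH) ?scale1r //; lin_solve.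
rewrite can_tmk -(psiK (1 \ot y)) yw -phi_act /can' phiK.
by rewrite !tmap_tmk ?mulr1 ?wy //; lin_solve.
Qed.

(** [can'] is left colinear, so applying the counit to the middle leg of the coaction recovers
    [can' (h (x) 1)] as [h_1 (x) S h_2]. *)
Let can'_one h : can' (h \ot 1) = tlift (fun a b => a \ot S b) (HD h).
Proof.
rewrite -[LHS](lco_counit_mid bH) /can' (lco_tmap bH) // psi_l (lcoE bH).
by tnl.
Qed.

Let right_mul y : tensor H H -> tensor H H := tmap id (fun x : H => x * y).

Let can_right_mul y t : can (right_mul y t) = right_mul y (can t).
Proof.
have rl : lin (right_mul y) by rewrite /right_mul; lin_solve.
move: t; apply: tensor_ext; [by lin_solve..|] => h z.
rewrite /right_mul tmap_tmk; [|lin_solve..].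
rewrite /can !tlift_tmk; [|lin_solve..].
by tnr; apply: eq_tlift => a b; rewrite mulrA.
Qed.

(** [can] commutes with right multiplication on the second factor, hence so does its inverse. *)
Let can'_tmk x y : can' (x \ot y) = right_mul y (can' (x \ot 1)).
Proof.
rewrite -[RHS]can'K can_right_mul canK' /right_mul tmap_tmk ?mul1r //; lin_solve.
Qed.

Lemma hopf_of_iso : hopf HD He.
Proof.
exists S; split=> // h.
(* Applying [eps (x) id] to [can' (h_1 (x) h_2) = h (x) 1] and pulling [h_2] out on the right gives
   [S(h_1) h_2 = eps(h) 1]. *)
- have := congr1 (@E H) (can'K (h \ot 1)).
  rewrite [in RHS]/E tlift_tmk; last by lin_solve.
  move=> <-; rewrite /can tlift_tmk; last by lin_solve.
  rewrite (lin_tlift _ _ canlin') (lin_tlift _ _ (@Elin H)).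
  apply: eq_tlift => a b; rewrite mulr1 can'_tmk /right_mul /E; tnr.
  rewrite /S /E (lin_tlift (L := fun x => x * b)); last by lin_solve.
  by apply: eq_tlift => c d; rewrite scalerAl.
(* By [E_can], [eps (x) id] after [can] is multiplication, so [can (h_1 (x) S h_2) = h (x) 1] gives
   the other identity. *)
- have := congr1 (@E H) (canK' (h \ot 1)).
  rewrite E_can can'_one [in RHS]/E tlift_tmk; last by lin_solve.
  by move=> <-; tnr.
Qed.

End Antipode.

(** The component of the counit [eps] at [diag_hmod] is the isomorphism [phi] from some
    [H (x) W]. *)
Lemma hopf_of_equiv : Psi_equiv HD He D -> hopf HD He.
Proof.
move=> [Go [Gm [_ _ _ [eps [/(_ diag_hmod diag_valid) [eh [g [gh gK Kg]]] _]]]]].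
case: eh => el ell _ ea; case: gh => gl gll _ _.
exact: hopf_of_iso gK Kg el gl ell gll ea.
Qed.

End Galois.

Lemma hopf_of_Psi_reg : Psi_equiv HD He (reg_mc HD He) -> hopf HD He.
Proof.
apply: (hopf_of_equiv reg_mc_valid (rho := HD)).
- by case: (bH) => [[? ? ? ? cr] _ _ _ _]; split.
- exact: HD_mul bH.
Qed.

Lemma hopf_of_Psi_triv : Psi_equiv HD He (triv_mc He) -> hopf HD He.
Proof.
apply: (hopf_of_equiv triv_mc_valid
  (rho := (fun h => h \ot (1 : F^o)) : H -> tensor H (mc_car (triv_mc He)))).
- have rl : lin (fun h : H => h \ot (1 : F^o)) by lin_solve.
  have dl := triv_mc_valid; case: dl => [[dl _ _ _ _] _ _ _].
  split=> //= m.
  + rewrite tmap_tmk // /tassoc tlift_tmk; last by lin_solve.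
    by rewrite tlift_tmk ?tmap_tmk ?scale1r //; lin_solve.
  + by rewrite tlift_tmk ?scale1r //; lin_solve.
- have [_ [al ar _ _] _ _] := triv_mc_valid.
  move=> h x; rewrite /dact.
  (* [H] acts on the trivial coalgebra through [eps], so linearity of [h |-> h (x) 1] is the counit
     law. *)
  transitivity (tlift (fun h1 h2 => (He h2 : F) *: ((h1 * x) \ot (1 : F^o))) (HD h)).
    by rewrite (HD_counitr bH (f := fun h1 => (h1 * x) \ot (1 : F^o))) //; lin_solve.
  apply: eq_tlift => h1 h2; rewrite tlift_tmk; last by lin_solve.
  rewrite -(linZ (f := fun z => (h1 * x) \ot z)) //; by lin_solve.
Qed.

End ModuleCoalgebras.

(** * Assembly of the equivalent conditions *)

Lemma coinv_quasi_inverse_equiv (F : fieldType) (H : algType F)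
    (HD : H -> tensor H H) (He : H -> F^o) (D : modcoalg H) :
  coinv_quasi_inverse HD He D -> Psi_equiv HD He D.
Proof. by move=> [Go [Gm [qi _]]]; exists Go, Gm. Qed.

Theorem theorem4p2 (F : fieldType) (H : algType F)
    (HD : H -> tensor H H) (He : H -> F^o) :
  bialgebra HD He ->
  [/\ hopf HD He <->
        (forall D : modcoalg H, is_modcoalg HD He D -> Psi_equiv HD He D),
      hopf HD He <-> Psi_equiv HD He (triv_mc He),
      hopf HD He <-> Psi_equiv HD He (reg_mc HD He) &
      hopf HD He ->
        forall D : modcoalg H, is_modcoalg HD He D ->
          coinv_quasi_inverse HD He D].
Proof.
move=> bH.
have coinv hH D := @hopf_coinv_quasi_inverse F H HD He D bH hH.
have equiv hH D (mD : is_modcoalg HD He D) :=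
  coinv_quasi_inverse_equiv (coinv hH D mD).
have vreg := reg_mc_valid bH; have vtriv := triv_mc_valid bH.
split=> //; split.
- exact: equiv.
- by move=> /(_ _ vreg); apply: hopf_of_Psi_reg.
- by move=> hH; apply: equiv.
- exact: hopf_of_Psi_triv.
- by move=> hH; apply: equiv.
- exact: hopf_of_Psi_reg.
Qed.
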